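(* Let $n\ge1$. The map $W\mapsto L_\bullet(W)$ (sending a homogeneous $\mathscr{D}_n^{+}$-module map $\phi:U\to W$ to the map $\phi_\bullet:L_\bullet(U)\to L_\bullet(W)$ obtained by restricting $\phi$ to each subspace $L_k(U)\subset U$) is a covariant functor from the category $\mathscr{D}_n^{+}\text{-}\mathrm{Mod}$ of graded left $\mathscr{D}_n^{+}$-modules to the category $\mathbb{B}_{q,t}^{(n)}\text{-}\mathrm{Mod}$ of graded left $\mathbb{B}_{q,t}^{(n)}$-modules.
   Context: Base field $\mathbb{Q}(q,t)$ with $q,t$ algebraically independent over $\mathbb{Q}$. ''Graded'' means $\mathbb{Z}_{\ge0}$-graded. For a graded algebra $R$, $R\text{-}\mathrm{Mod}$ is the category of graded left $R$-modules with degree-preserving homomorphisms. **Positive DAHA.** $\mathscr{D}_n^{+}$ is the $\mathbb{Q}(q,t)$-algebra generated by $T_1,\dots,T_{n-1}$, $X_1,\dots,X_n$, $Y_1,\dots,Y_n$ with relations: $(T_i-1)(T_i+q)=0$; $T_iT_{i+1}T_i=T_{i+1}T_iT_{i+1}$; $T_iT_j=T_jT_i$ for $|i-j|>1$; $T_i^{-1}X_iT_i^{-1}=q^{-1}X_{i+1}$; $T_iX_j=X_jT_i$ for $j\notin\{i,i+1\}$; $X_iX_j=X_jX_i$; $T_iY_iT_i=qY_{i+1}$; $T_iY_j=Y_jT_i$ for $j\notin\{i,i+1\}$; $Y_iY_j=Y_jY_i$; $Y_1T_1X_1=X_2Y_1T_1$; $Y_1X_1\cdots X_n=tX_1\cdots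 X_nY_1$. It is graded by $\deg T_i=\deg Y_i=0$, $\deg X_i=1$. For $0\le k\le n$, $$\epsilon_k=\frac{1}{[n-k]_q!}\sum_{\sigma\in\mathfrak{S}_{(1^k,n-k)}}q^{\binom{n-k}{2}-\ell(\sigma)}T_\sigma,$$ where $\mathfrak{S}_{(1^k,n-k)}\subset\mathfrak{S}_n$ is the Young subgroup of the composition $(1^k,n-k)$, $T_\sigma=T_{i_1}\cdots T_{i_r}$ for a reduced expression $\sigma=s_{i_1}\cdots s_{i_r}$, and $[m]_q!=\prod_{i=1}^m\frac{1-q^i}{1-q}$. **The algebra $\mathbb{B}_{q,t}$.** It is the path algebra generated by orthogonal idempotents $e_k$ ($k\in\mathbb{Z}_{\ge0}$) and, at each vertex $k$, generators $T_1,\dots,T_{k-1}$ and $z_1,\dots,z_k$ (from $k$ to $k$), $d_+$ (from $k$ to $k+1$), $d_-$ (from $k$ to $k-1$, for $k\ge1$), modulo the following relations (where $k$ denotes the source vertex, and operators compose right to left): $(T_i-1)(T_i+q)=0$; $T_iT_{i+1}T_i=T_{i+1}T_iT_{i+1}$; $T_iT_j=T_jT_i$ if $|i-j|>1$; $T_i^{-1}z_{i+1}T_i^{-1}=q^{-1}z_i$ for $1\le i\le k-1$; $z_iT_j=T_jz_i$ if $i\notin\{j,j+1\}$; $z_iz_j=z_jz_i$ for $1\le i,j\le k$; $d_-^2T_{k-1}=d_-^2$ for $k\ge2$; $d_-T_i=T_id_-$ for $1\le i\le k-2$; $T_1d_+^2=d_+^2$; $d_+T_i=T_{i+1}d_+$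 for $1\le i\le k-1$; $q\varphi d_-=d_-\varphi T_{k-1}$ for $k\ge2$; $T_1\varphi d_+=qd_+\varphi$ for $k\ge1$; $z_id_-=d_-z_i$ (for $1\le i\le k-1$); $d_+z_i=z_{i+1}d_+$ (for $1\le i\le k$); $z_1(qd_+d_--d_-d_+)=qt(d_+d_--d_-d_+)z_k$ for $k\ge1$; where $\varphi=\frac{1}{q-1}[d_+,d_-]$. It is graded by $\deg T_i=\deg z_i=\deg d_-=0$, $\deg d_+=1$. $\mathbb{B}_{q,t}^{(n)}$ is the subalgebra of $\mathbb{B}_{q,t}$ given by only considering $T_i,z_i,d_-,d_+$ between the idempotents labelled $0,\dots,n$. **The module $L_\bullet(V)$.** For a graded $\mathscr{D}_n^{+}$-module $V$, put $L_k(V)=X_1\cdots X_k\,\epsilon_k(V)\subset V$ and $L_\bullet(V)=\bigoplus_{0\le k\le n}L_k(V)$, with grading inherited from $V$. It is a $\mathbb{B}_{q,t}^{(n)}$-module with $e_k$ acting as projection onto $L_k(V)$ and, for $v\in L_k(V)$: $T_i(v)=T_iv$ ($1\le i\le k-1$); $z_i(v)=(qt)^{-1}Y_iv$ ($1\le i\le k$); $d_+(v)=q^kX_1T_1^{-1}\cdots T_k^{-1}v\in L_{k+1}(V)$ ($0\le k\le n-1$); $d_-(v)=(q-1)(1+qT_k^{-1}+\cdots+q^{n-k}T_{n-1}^{-1}\cdots T_k^{-1})v\in L_{k-1}(V)$ ($1\le k\le n$).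
   Formalization: The positive DAHA is taken as the subalgebra generated by the T_i, X_i, Y_i in the DAHA with invertible X_i, Y_i, not as the algebra presented by the listed relations alone, for which L_1 can fail to be stable under Y_1 when n=2. *)

(* Defs.v *)
From HB Require Import structures.
From mathcomp Require Import all_boot all_order all_fingroup all_algebra.
From mathcomp Require Import all_classical.
From mathcomp Require Import generic_quotient.
Set Implicit Arguments.
Unset Strict Implicit.
Unset Printing Implicit Defensive.
Import Order.TTheory GRing.Theory.
Local Open Scope ring_scope.
Local Open Scope classical_set_scope.
Local Open Scope quotient_scope.

(** Non-commutative polynomial expressions over [K] in the letters [G]. *)
Inductive nexpr (K G : Type) : Type :=
| Gen of G
| Cst of K
| Add of nexpr K G & nexpr K G
| Mul of nexpr K G & nexpr K G.
Arguments Gen {K G}.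
Arguments Cst {K G}.

HB.instance Definition _ (K G : Type) := gen_eqMixin (nexpr K G).
HB.instance Definition _ (K G : Type) := gen_choiceMixin (nexpr K G).

Declare Scope nexpr_scope.
Delimit Scope nexpr_scope with nx.
Bind Scope nexpr_scope with nexpr.
Notation "c %:C" := (Cst c%R) : nexpr_scope.
Notation "x + y" := (Add x y) : nexpr_scope.
Notation "x * y" := (Mul x y) : nexpr_scope.
Notation "c *: x" := (Mul (Cst c%R) x) : nexpr_scope.
Notation "x - y" := (Add x (Mul (Cst (-1)%R) y)) : nexpr_scope.

Section Presented.
Variables (K : fieldType) (G : Type).
Variable R : nexpr K G -> nexpr K G -> Prop.

(** The least congruence containing [R] and the axioms of [K]-algebras. *)
Inductive pcong : nexpr K G -> nexpr K G -> Prop :=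
| pc_rel x y : R x y -> pcong x y
| pc_refl x : pcong x x
| pc_sym x y : pcong x y -> pcong y x
| pc_trans x y z : pcong x y -> pcong y z -> pcong x z
| pc_add x x' y y' : pcong x x' -> pcong y y' -> pcong (x + y)%nx (x' + y')%nx
| pc_mul x x' y y' : pcong x x' -> pcong y y' -> pcong (x * y)%nx (x' * y')%nx
| pc_addA x y z : pcong (x + (y + z))%nx (x + y + z)%nx
| pc_addC x y : pcong (x + y)%nx (y + x)%nx
| pc_add0 x : pcong (0%:C + x)%nx x
| pc_mulA x y z : pcong (x * (y * z))%nx (x * y * z)%nx
| pc_mul1 x : pcong (1%:C * x)%nx x
| pc_mul0 x : pcong (0%:C * x)%nx 0%:C%nx
| pc_mulDl x y z : pcong ((x + y) * z)%nx (x * z + y * z)%nx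
| pc_mulDr x y z : pcong (x * (y + z))%nx (x * y + x * z)%nx
| pc_cstD a b : pcong (a + b)%:C%nx (a%:C + b%:C)%nx
| pc_cstM a b : pcong (a * b)%:C%nx (a%:C * b%:C)%nx
| pc_cstC a x : pcong (a%:C * x)%nx (x * a%:C)%nx.

Definition pcongb x y := `[< pcong x y >].

Lemma pcongb_refl : reflexive pcongb.
Proof. by move=> x; apply/asboolP; apply: pc_refl. Qed.

Lemma pcongb_sym : symmetric pcongb.
Proof. by move=> x y; apply/asboolP/asboolP; apply: pc_sym. Qed.

Lemma pcongb_trans : transitive pcongb.
Proof.
by move=> y x z /asboolP xy /asboolP yz; apply/asboolP; apply: pc_trans xy yz.
Qed.

Canonical pcong_equiv := EquivRel pcongb pcongb_refl pcongb_sym pcongb_trans.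

Definition palg := {eq_quot pcong_equiv}.
HB.instance Definition _ := Choice.on palg.

Definition pcls (x : nexpr K G) : palg := \pi x.

Lemma pclsP x y : pcls x = pcls y <-> pcong x y.
Proof.
split; first by move=> /eqmodP /asboolP.
by move=> xy; apply/eqmodP/asboolP.
Qed.

Lemma pcls_repr (x : palg) : pcls (repr x) = x.
Proof. exact: reprK. Qed.

Lemma repr_pcls x : pcong (repr (pcls x)) x.
Proof. by apply/pclsP; rewrite pcls_repr. Qed.

Lemma pcls_ind (P : palg -> Prop) : (forall x, P (pcls x)) -> forall x, P x.
Proof. by move=> PP x; rewrite -[x]pcls_repr. Qed.

Definition padd (x y : palg) := pcls (repr x + repr y)%nx.
Definition pmul (x y : palg) := pcls (repr x * repr y)%nx.
Definition popp (x : palg) := pcls ((-1)%R *: repr x)%nx.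

Lemma paddE x y : padd (pcls x) (pcls y) = pcls (x + y)%nx.
Proof. by apply/pclsP/pc_add; apply: repr_pcls. Qed.

Lemma pmulE x y : pmul (pcls x) (pcls y) = pcls (x * y)%nx.
Proof. by apply/pclsP/pc_mul; apply: repr_pcls. Qed.

Lemma poppE x : popp (pcls x) = pcls ((-1)%R *: x)%nx.
Proof. by apply/pclsP/pc_mul; [apply: pc_refl | apply: repr_pcls]. Qed.

Lemma paddA : associative padd.
Proof.
elim/pcls_ind=> x; elim/pcls_ind=> y; elim/pcls_ind=> z.
by rewrite !paddE; apply/pclsP/pc_addA.
Qed.

Lemma paddC : commutative padd.
Proof.
elim/pcls_ind=> x; elim/pcls_ind=> y.
by rewrite !paddE; apply/pclsP/pc_addC.
Qed.

Lemma padd0 : left_id (pcls 0%:C%nx) padd.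
Proof. by elim/pcls_ind=> x; rewrite paddE; apply/pclsP/pc_add0. Qed.

Lemma paddN : left_inverse (pcls 0%:C%nx) popp padd.
Proof.
elim/pcls_ind=> x; rewrite poppE paddE; apply/pclsP.
apply: (@pc_trans _ (((-1)%:C + 1%:C) * x)%nx).
  apply: (@pc_trans _ ((-1)%R *: x + 1%R *: x)%nx).
    by apply: pc_add (pc_refl _) _; apply/pc_sym/pc_mul1.
  exact/pc_sym/pc_mulDl.
apply: pc_trans _ (pc_mul0 x); apply: pc_mul (pc_refl _).
by rewrite -[X in pcong _ X%:C%nx](addNr 1); apply/pc_sym/pc_cstD.
Qed.

HB.instance Definition _ := GRing.isZmodule.Build palg paddA paddC padd0 paddN.

Lemma pmulA : associative pmul.
Proof.
elim/pcls_ind=> x; elim/pcls_ind=> y; elim/pcls_ind=> z.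
by rewrite !pmulE; apply/pclsP/pc_mulA.
Qed.

Lemma pmul1l : left_id (pcls 1%:C%nx) pmul.
Proof. by elim/pcls_ind=> x; rewrite pmulE; apply/pclsP/pc_mul1. Qed.

Lemma pmul1r : right_id (pcls 1%:C%nx) pmul.
Proof.
elim/pcls_ind=> x; rewrite pmulE; apply/pclsP.
exact: pc_trans (pc_sym (pc_cstC _ _)) (pc_mul1 _).
Qed.

Lemma pmulDl : left_distributive pmul padd.
Proof.
elim/pcls_ind=> x; elim/pcls_ind=> y; elim/pcls_ind=> z.
by rewrite !(paddE, pmulE); apply/pclsP/pc_mulDl.
Qed.

Lemma pmulDr : right_distributive pmul padd.
Proof.
elim/pcls_ind=> x; elim/pcls_ind=> y; elim/pcls_ind=> z.
by rewrite !(paddE, pmulE); apply/pclsP/pc_mulDr.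
Qed.

HB.instance Definition _ :=
  GRing.Zmodule_isPzRing.Build palg pmulA pmul1l pmul1r pmulDl pmulDr.

(** The structure map [K -> palg]. The [algType] hierarchy only covers
    algebras known to be nonzero, hence this explicit map. *)
Definition pcst (c : K) : palg := pcls c%:C%nx.
Definition pgen (g : G) : palg := pcls (Gen g).

Lemma pclsD x y : pcls (x + y)%nx = pcls x + pcls y.
Proof. by rewrite -paddE. Qed.

Lemma pclsM x y : pcls (x * y)%nx = pcls x * pcls y.
Proof. by rewrite -pmulE. Qed.

Lemma pcst1 : pcst 1 = 1. Proof. by []. Qed.

Lemma pcstM a b : pcst (a * b) = pcst a * pcst b.
Proof. by rewrite -pclsM; apply/pclsP/pc_cstM. Qed.

Lemma pcstD a b : pcst (a + b) = pcst a + pcst b.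
Proof. by rewrite -pclsD; apply/pclsP/pc_cstD. Qed.

Lemma pcstC a x : pcst a * x = x * pcst a.
Proof. by elim/pcls_ind: x => x; rewrite -!pclsM; apply/pclsP/pc_cstC. Qed.

End Presented.

Section Subalgebra.
Variables (K : fieldType) (G : Type) (R : nexpr K G -> nexpr K G -> Prop).
Variable I : Type.
Local Notation A := (palg R).

Record unital_family := UnitalFamily {
  ufam :> I -> A;
  uone : A;
  uone_idem : uone * uone = uone;
  uone_l : forall i, uone * ufam i = ufam i;
  uone_r : forall i, ufam i * uone = ufam i }.

Variable S : unital_family.

Inductive in_subalg : A -> Prop :=
| isa_gen i : in_subalg (S i)
| isa_cst c : in_subalg (pcst R c * uone S)
| isa_sub x y : in_subalg x -> in_subalg y -> in_subalg (x - y)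
| isa_mul x y : in_subalg x -> in_subalg y -> in_subalg (x * y).

Definition subalg_pred : {pred A} := fun x => `[< in_subalg x >].

Lemma subalg_zmod_closed : zmod_closed subalg_pred.
Proof.
split=> [|x y /asboolP xS /asboolP yS]; apply/asboolP; last exact: isa_sub.
by rewrite -(subrr (pcst R 1 * uone S)); apply: isa_sub; apply: isa_cst.
Qed.

HB.instance Definition _ := GRing.isZmodClosed.Build A subalg_pred
  subalg_zmod_closed.

Record subalg := SubAlg { sa_val : A; sa_valP : sa_val \in subalg_pred }.

HB.instance Definition _ := [isSub for sa_val].
HB.instance Definition _ := [Choice of subalg by <:].
HB.instance Definition _ := [SubChoice_isSubZmodule of subalg by <:].

Lemma sa_mem (x : subalg) : in_subalg (val x).
Proof. by apply/asboolP; apply: sa_valP. Qed.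

Lemma uone_subalg x : in_subalg x -> uone S * x = x /\ x * uone S = x.
Proof.
elim=> {x} [i|c|x y _ [xl xr] _ [yl yr]|x y _ [xl xr] _ [yl yr]].
- by rewrite uone_l uone_r.
- by rewrite mulrA -pcstC -!mulrA uone_idem.
- by rewrite mulrBl mulrBr xl xr yl yr.
- by rewrite mulrA xl -mulrA yr.
Qed.

Definition sa_one : subalg.
Proof.
exists (uone S); apply/asboolP.
by rewrite -[uone S]mul1r -(pcst1 R); apply: isa_cst.
Defined.

Definition sa_mul (x y : subalg) : subalg.
Proof.
by exists (val x * val y); apply/asboolP/isa_mul; apply: sa_mem.
Defined.

Lemma sa_mulA : associative sa_mul.
Proof. by move=> x y z; apply: val_inj; rewrite /= mulrA. Qed.

Lemma sa_mul1l : left_id sa_one sa_mul.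
Proof. by move=> x; apply: val_inj; case: (uone_subalg (sa_mem x)). Qed.

Lemma sa_mul1r : right_id sa_one sa_mul.
Proof. by move=> x; apply: val_inj; case: (uone_subalg (sa_mem x)). Qed.

Lemma sa_mulDl : left_distributive sa_mul +%R.
Proof. by move=> x y z; apply: val_inj; rewrite /= mulrDl. Qed.

Lemma sa_mulDr : right_distributive sa_mul +%R.
Proof. by move=> x y z; apply: val_inj; rewrite /= mulrDr. Qed.

HB.instance Definition _ := GRing.Zmodule_isPzRing.Build subalg
  sa_mulA sa_mul1l sa_mul1r sa_mulDl sa_mulDr.

Definition sa_gen (i : I) : subalg.
Proof. by exists (S i); apply/asboolP/isa_gen. Defined.

Definition sa_cst (c : K) : subalg.
Proof. by exists (pcst R c * uone S); apply/asboolP/isa_cst. Defined.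

(** The homogeneous elements, when the [i]-th generator has degree [deg i]. *)
Inductive sa_homog (deg : I -> nat) : nat -> set subalg :=
| sh_gen i : sa_homog deg (deg i) (sa_gen i)
| sh_cst c : sa_homog deg 0 (sa_cst c)
| sh_0 d : sa_homog deg d 0
| sh_add d x y : sa_homog deg d x -> sa_homog deg d y -> sa_homog deg d (x + y)
| sh_mul d e x y :
    sa_homog deg d x -> sa_homog deg e y -> sa_homog deg (d + e) (x * y).

End Subalgebra.

Record category := Category {
  obj :> Type;
  mor : obj -> obj -> Type;
  idm : forall U, mor U U;
  cmp : forall U V W, mor V W -> mor U V -> mor U W;
  cmp1m : forall U V (f : mor U V), cmp (idm V) f = f;
  cmpm1 : forall U V (f : mor U V), cmp f (idm U) = f;
  cmpA : forall U V W Z (h : mor W Z) (g : mor V W) (f : mor U V),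
    cmp h (cmp g f) = cmp (cmp h g) f }.

Record functor_on (C D : category) (F : C -> D) := FunctorOn {
  fmor : forall U V : C, mor U V -> mor (F U) (F V);
  fmor1 : forall U : C, fmor (idm U) = idm (F U);
  fmorM : forall (U V W : C) (g : mor V W) (f : mor U V),
    fmor (cmp g f) = cmp (fmor g) (fmor f) }.

Section GradedModules.
Variables (R : pzRingType) (Rd : nat -> set R).

Record is_grading (V : lmodType R) (Vd : nat -> set V) : Prop := IsGrading {
  grad0 : forall d, Vd d 0;
  gradB : forall d v w, Vd d v -> Vd d w -> Vd d (v - w);
  grad_span : forall v, exists N (w : nat -> V),
    (forall d, Vd d (w d)) /\ v = \sum_(d < N) w d;
  grad_free : forall N (w : nat -> V), (forall d, Vd d (w d)) ->
    \sum_(d < N) w d = 0 -> forall d, (d < N)%N -> w d = 0;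
  grad_act : forall d e a v, Rd d a -> Vd e v -> Vd (d + e)%N (a *: v) }.

Record gmod := GMod {
  gm_sort :> lmodType R;
  gm_deg : nat -> set gm_sort;
  gm_grading : is_grading gm_deg }.

Record gmor (U W : gmod) := GMor {
  gm_fun :> {linear U -> W};
  gm_funP : forall d v, gm_deg (g := U) d v -> gm_deg (g := W) d (gm_fun v) }.

Lemma gmorP (U W : gmod) (f g : gmor U W) : f =1 g -> f = g.
Proof.
case: f g => [[f cf] fP] [[g cg] gP] /= /funext fg.
case: _ / fg in cg gP *; have E : cf = cg.
  by case: cf cg {fP gP} => [[a] [b]] [[a'] [b']];
     rewrite (Prop_irrelevance a a') (Prop_irrelevance b b').
by case: _ / E in gP *; rewrite (Prop_irrelevance fP gP).
Qed.

Definition gmor_id (U : gmod) : gmor U U := @GMor U U idfun (fun _ _ h => h).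

Definition gmor_comp (U V W : gmod) (g : gmor V W) (f : gmor U V) : gmor U W :=
  @GMor U W (g \o f) (fun d v h => gm_funP g (gm_funP f h)).

Definition gmodCat : category.
Proof.
refine (@Category gmod gmor gmor_id gmor_comp _ _ _) => *; exact: gmorP.
Defined.

End GradedModules.

Section DAHA.
Variables (K : fieldType) (q t : K) (n : nat).

(** Indices run from 1; generators with an index outside their range are set
    to 0 by [dr_out], [dr_Xinv_out] and [dr_Yinv_out]. *)
Inductive dgen := DT of nat | DX of nat | DY of nat.
Inductive dahagen := DPos of dgen | DXinv of nat | DYinv of nat.

Definition dgen_ok (g : dgen) : bool :=
  match g with
  | DT i => 0 < i < n
  | DX i | DY i => 0 < i <= n
  end%N.

Local Notation tm := (nexpr K dahagen).
Local Notation T i := (Gen (DPos (DT i%N)) : tm).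
Local Notation X i := (Gen (DPos (DX i%N)) : tm).
Local Notation Y i := (Gen (DPos (DY i%N)) : tm).
(** By the quadratic relation, [T_i^-1 = q^-1 (T_i + q - 1)]. *)
Local Notation Ti i := (q^-1 *: (T i + (q - 1)%:C))%nx.

Definition dprodX : tm := foldr (fun i u => X i * u)%nx 1%:C%nx (iota 1 n).

Inductive daha_rel : tm -> tm -> Prop :=
| dr_out g : ~~ dgen_ok g -> daha_rel (Gen (DPos g)) 0%:C
| dr_Xinv_l i : (0 < i <= n)%N -> daha_rel (Gen (DXinv i) * X i) 1%:C
| dr_Xinv_r i : (0 < i <= n)%N -> daha_rel (X i * Gen (DXinv i)) 1%:C
| dr_Xinv_out i : ~~ (0 < i <= n)%N -> daha_rel (Gen (DXinv i)) 0%:C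
| dr_Yinv_l i : (0 < i <= n)%N -> daha_rel (Gen (DYinv i) * Y i) 1%:C
| dr_Yinv_r i : (0 < i <= n)%N -> daha_rel (Y i * Gen (DYinv i)) 1%:C
| dr_Yinv_out i : ~~ (0 < i <= n)%N -> daha_rel (Gen (DYinv i)) 0%:C
| dr_quad i : (0 < i < n)%N -> daha_rel ((T i - 1%:C) * (T i + q%:C)) 0%:C
| dr_braid i : (0 < i)%N -> (i.+1 < n)%N ->
    daha_rel (T i * T i.+1 * T i) (T i.+1 * T i * T i.+1)
| dr_TT i j : (0 < i < n)%N -> (0 < j < n)%N -> (i.+1 < j)%N || (j.+1 < i)%N ->
    daha_rel (T i * T j) (T j * T i)
| dr_TXT i : (0 < i < n)%N -> daha_rel (Ti i * X i * Ti i) (q^-1 *: X i.+1)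
| dr_TX i j : (0 < i < n)%N -> (0 < j <= n)%N -> j != i -> j != i.+1 ->
    daha_rel (T i * X j) (X j * T i)
| dr_XX i j : (0 < i <= n)%N -> (0 < j <= n)%N -> daha_rel (X i * X j) (X j * X i)
| dr_TYT i : (0 < i < n)%N -> daha_rel (T i * Y i * T i) (q *: Y i.+1)
| dr_TY i j : (0 < i < n)%N -> (0 < j <= n)%N -> j != i -> j != i.+1 ->
    daha_rel (T i * Y j) (Y j * T i)
| dr_YY i j : (0 < i <= n)%N -> (0 < j <= n)%N -> daha_rel (Y i * Y j) (Y j * Y i)
| dr_YTX : (1 < n)%N -> daha_rel (Y 1 * T 1 * X 1) (X 2 * Y 1 * T 1)
| dr_YX : (0 < n)%N -> daha_rel (Y 1 * dprodX) (t *: (dprodX * Y 1)).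

Definition dpos_family : unital_family daha_rel dgen.
Proof.
refine (@UnitalFamily _ _ daha_rel dgen (fun g => pgen daha_rel (DPos g)) 1
          _ _ _).
- exact: mulr1.
- by move=> i; apply: mul1r.
- by move=> i; apply: mulr1.
Defined.

(** The positive part: the subalgebra of the double affine Hecke algebra
    [palg daha_rel] generated by the [T_i], [X_i] and [Y_i].  Working inside
    the algebra in which the [X_i] are invertible matters: when n > 1, the
    relations that do not involve inverses do not, by themselves, imply
    [q Y_1 X_1 T_1^-1 = t X_1 Y_1 T_1] (n = 2) and its analogues, which make
    [L_k] stable under the [Y_i]. *)
Definition Dplus := subalg dpos_family.
HB.instance Definition _ := GRing.PzRing.on Dplus.

Definition dcst (c : K) : Dplus := sa_cst dpos_family c.
Definition dT (i : nat) : Dplus := sa_gen dpos_family (DT i).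
Definition dX (i : nat) : Dplus := sa_gen dpos_family (DX i).
Definition dY (i : nat) : Dplus := sa_gen dpos_family (DY i).
Definition dTinv (i : nat) : Dplus := dcst q^-1 * (dT i + dcst (q - 1)).

Definition dgen_deg (g : dgen) : nat := if g is DX _ then 1 else 0.
Definition Dplus_deg : nat -> set Dplus := sa_homog (S := dpos_family) dgen_deg.

(** The simple transposition exchanging the [i]-th and [i.+1]-st letters;
    letters are the elements of ['I_n], so that the [i]-th one is [i.-1]. *)
Definition stransp (i : nat) : 'S_n :=
  match insub i.-1, insub i with
  | Some a, Some b => tperm a b
  | _, _ => 1%g
  end.

Definition expresses (s : 'S_n) (w : seq nat) : Prop :=
  all (fun i => 0 < i < n)%N w /\ s = (\prod_(i <- w) stransp i)%g.

Definition reduced_expr (s : 'S_n) (w : seq nat) : Prop :=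
  expresses s w /\ forall w', expresses s w' -> (size w <= size w')%N.

(** Products in ['S_n] compose from left to right; reading expressions in the
    opposite order would replace [Tperm s] by [Tperm s^-1], which does not affect
    the sum over a subgroup in [deps]. *)
Definition redword (s : 'S_n) : seq nat := xget [::] [set w | reduced_expr s w].
Definition plength (s : 'S_n) : nat := size (redword s).
Definition Tperm (s : 'S_n) : Dplus := \prod_(i <- redword s) dT i.

Definition qfact (m : nat) : K := \prod_(1 <= i < m.+1) ((1 - q ^+ i) / (1 - q)).

(** The Young subgroup of the composition (1^k, n - k). *)
Definition young (k : nat) : {set 'S_n} :=
  [set s : 'S_n | [forall i : 'I_n, (i < k)%N ==> (s i == i)]]%SET.

Definition deps (k : nat) : Dplus :=
  dcst (qfact (n - k))^-1 *
  \sum_(s in young k)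
     dcst (q ^ ('C(n - k, 2)%:Z - (plength s)%:Z)) * Tperm s.

End DAHA.

Section Bqt.
Variables (K : fieldType) (q t : K).

(** In [BT k i] and [Bz k i], [k] is the vertex and [i] the index; in [Bdp k]
    and [Bdm k], [k] is the source. *)
Inductive bgen :=
| Be of nat | BT of nat & nat | Bz of nat & nat | Bdp of nat | Bdm of nat.

Definition bgen_ok (g : bgen) : bool :=
  match g with
  | Be _ | Bdp _ => true
  | BT k i => 0 < i < k
  | Bz k i => 0 < i <= k
  | Bdm k => 0 < k
  end%N.

Definition bsrc (g : bgen) : nat :=
  match g with Be k | BT k _ | Bz k _ | Bdp k | Bdm k => k end.
Definition btgt (g : bgen) : nat :=
  match g with Be k | BT k _ | Bz k _ => k | Bdp k => k.+1 | Bdm k => k.-1 end.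

Local Notation tm := (nexpr K bgen).
Local Notation e k := (Gen (Be k%N) : tm).
Local Notation T k i := (Gen (BT k%N i%N) : tm).
Local Notation z k i := (Gen (Bz k%N i%N) : tm).
Local Notation dp k := (Gen (Bdp k%N) : tm).
Local Notation dm k := (Gen (Bdm k%N) : tm).
Local Notation Ti k i := (q^-1 *: (T k i + (q - 1) *: e k))%nx.

(** [varphi = (q - 1)^-1 [d_+, d_-]] at the vertex [k > 0]. *)
Definition bphi (k : nat) : tm :=
  ((q - 1)^-1 *: (dp k.-1 * dm k - dm k.+1 * dp k))%nx.

(** The vertex [k] is the source of the paths involved. *)
Inductive B_rel : tm -> tm -> Prop :=
| br_out g : ~~ bgen_ok g -> B_rel (Gen g) 0%:C
| br_ee k l : k != l -> B_rel (e k * e l) 0%:C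
| br_e k : B_rel (e k * e k) (e k)
| br_src g : B_rel (Gen g * e (bsrc g)) (Gen g)
| br_tgt g : B_rel (e (btgt g) * Gen g) (Gen g)
| br_quad k i : (0 < i < k)%N -> B_rel ((T k i - e k) * (T k i + q *: e k)) 0%:C
| br_braid k i : (0 < i)%N -> (i.+1 < k)%N ->
    B_rel (T k i * T k i.+1 * T k i) (T k i.+1 * T k i * T k i.+1)
| br_TT k i j : (0 < i < k)%N -> (0 < j < k)%N -> (i.+1 < j)%N || (j.+1 < i)%N ->
    B_rel (T k i * T k j) (T k j * T k i)
| br_TzT k i : (0 < i < k)%N ->
    B_rel (Ti k i * z k i.+1 * Ti k i) (q^-1 *: z k i)
| br_zT k i j : (0 < i <= k)%N -> (0 < j < k)%N -> i != j -> i != j.+1 ->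
    B_rel (z k i * T k j) (T k j * z k i)
| br_zz k i j : (0 < i <= k)%N -> (0 < j <= k)%N ->
    B_rel (z k i * z k j) (z k j * z k i)
| br_dmdmT k : (2 <= k)%N ->
    B_rel (dm k.-1 * dm k * T k k.-1) (dm k.-1 * dm k)
| br_dmT k i : (0 < i <= k - 2)%N -> B_rel (dm k * T k i) (T k.-1 i * dm k)
| br_Tdpdp k : B_rel (T k.+2 1 * dp k.+1 * dp k) (dp k.+1 * dp k)
| br_dpT k i : (0 < i < k)%N -> B_rel (dp k * T k i) (T k.+1 i.+1 * dp k)
| br_phidm k : (2 <= k)%N ->
    B_rel (q *: (bphi k.-1 * dm k)) (dm k * bphi k * T k k.-1)
| br_phidp k : (0 < k)%N ->
    B_rel (T k.+1 1 * bphi k.+1 * dp k) (q *: (dp k * bphi k))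
| br_zdm k i : (0 < i < k)%N -> B_rel (z k.-1 i * dm k) (dm k * z k i)
| br_dpz k i : (0 < i <= k)%N -> B_rel (dp k * z k i) (z k.+1 i.+1 * dp k)
| br_zdd k : (0 < k)%N ->
    B_rel (z k 1 * (q *: (dp k.-1 * dm k) - dm k.+1 * dp k))
          ((q * t)%R *: ((dp k.-1 * dm k - dm k.+1 * dp k) * z k k)).

(** [palg B_rel] is the (non-unital) path algebra B_{q,t} with a unit
    adjoined; this unit plays no role in the subalgebras [Bn] below, whose
    unit is [e_0 + ... + e_n]. *)

Variable n : nat.

Definition bgen_upto (g : bgen) : bool := (bsrc g <= n)%N && (btgt g <= n)%N.

Definition Bn_fam (g : bgen) : palg B_rel :=
  if bgen_upto g then pgen B_rel g else 0.

Definition Bn_one : palg B_rel := \sum_(k < n.+1) pgen B_rel (Be k).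

Lemma pgen_ee k l :
  pgen B_rel (Be k) * pgen B_rel (Be l) = if k == l then pgen B_rel (Be k) else 0.
Proof.
rewrite -pclsM; have [<-|kl] := eqVneq k l; apply/pclsP/pc_rel; first exact: br_e.
exact: br_ee.
Qed.

Lemma Bn_one_l k x : (k <= n)%N -> pgen B_rel (Be k) * x = x -> Bn_one * x = x.
Proof.
move=> kn <-; rewrite mulrA; congr (_ * _).
rewrite /Bn_one mulr_suml (bigD1 (Ordinal (kn : k < n.+1)%N)) //=.
rewrite pgen_ee eqxx big1 ?addr0 // => i; rewrite -val_eqE /= pgen_ee.
by move/negPf ->.
Qed.

Lemma Bn_one_r k x : (k <= n)%N -> x * pgen B_rel (Be k) = x -> x * Bn_one = x.
Proof.
move=> kn <-; rewrite -mulrA; congr (_ * _).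
rewrite /Bn_one mulr_sumr (bigD1 (Ordinal (kn : k < n.+1)%N)) //=.
rewrite pgen_ee eqxx big1 ?addr0 // => i; rewrite -val_eqE /= pgen_ee eq_sym.
by move/negPf ->.
Qed.

Definition Bn_family : unital_family B_rel bgen.
Proof.
refine (@UnitalFamily _ _ B_rel bgen Bn_fam Bn_one _ _ _).
- rewrite {2}/Bn_one mulr_sumr; apply: eq_bigr => k _.
  by apply: (@Bn_one_l k); rewrite ?pgen_ee ?eqxx // -ltnS.
- move=> g; rewrite /Bn_fam; case: ifP => [/andP[_ gn]|_]; last by rewrite mulr0.
  by apply: Bn_one_l gn _; rewrite -pclsM; apply/pclsP/pc_rel/br_tgt.
- move=> g; rewrite /Bn_fam; case: ifP => [/andP[gn _]|_]; last by rewrite mul0r.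
  by apply: Bn_one_r gn _; rewrite -pclsM; apply/pclsP/pc_rel/br_src.
Defined.

Definition Bn := subalg Bn_family.
HB.instance Definition _ := GRing.PzRing.on Bn.

Definition bcst (c : K) : Bn := sa_cst Bn_family c.
Definition be (k : nat) : Bn := sa_gen Bn_family (Be k).
Definition bT (k i : nat) : Bn := sa_gen Bn_family (BT k i).
Definition bz (k i : nat) : Bn := sa_gen Bn_family (Bz k i).
Definition bdp (k : nat) : Bn := sa_gen Bn_family (Bdp k).
Definition bdm (k : nat) : Bn := sa_gen Bn_family (Bdm k).

Definition bgen_deg (g : bgen) : nat := if g is Bdp _ then 1 else 0.
Definition Bn_deg : nat -> set Bn := sa_homog (S := Bn_family) bgen_deg.

End Bqt.

Section Lbullet.
Variables (K : fieldType) (q t : K) (n : nat).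
Local Notation D := (Dplus q t n).
Local Notation B := (Bn q t n).
Local Notation DMod := (gmodCat (@Dplus_deg K q t n)).
Local Notation BMod := (gmodCat (@Bn_deg K q t n)).
Local Notation T := (dT q t n).
Local Notation X := (dX q t n).
Local Notation Y := (dY q t n).
Local Notation Tinv := (dTinv q t n).
Local Notation cst := (dcst q t n).

Definition Lproj (k : nat) : D := (\prod_(1 <= i < k.+1) X i) * deps q t n k.

Definition Lk (V : lmodType D) (k : nat) : set V := range (fun v => Lproj k *: v).
Arguments Lk : clear implicits.

Lemma Lk_zmod (V : lmodType D) k :
  Lk V k 0 /\ forall v w, Lk V k v -> Lk V k w -> Lk V k (v - w).
Proof.
split; first by exists 0; rewrite ?scaler0.
by move=> _ _ [v _ <-] [w _ <-]; exists (v - w); rewrite ?scalerBr.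
Qed.

Definition Lpred (V : lmodType D) : {pred {ffun 'I_n.+1 -> V}} :=
  fun x => `[< forall k : 'I_n.+1, Lk V k (x k) >].
Arguments Lpred : clear implicits.

Lemma Lpred_zmod_closed (V : lmodType D) : zmod_closed (Lpred V).
Proof.
split=> [|x y /asboolP xL /asboolP yL]; apply/asboolP => k; rewrite !ffunE.
  by case: (Lk_zmod V k).
by case: (Lk_zmod V k) => _; apply.
Qed.

HB.instance Definition _ (V : lmodType D) :=
  GRing.isZmodClosed.Build {ffun 'I_n.+1 -> V} (Lpred V) (Lpred_zmod_closed V).

(** The external direct sum of the [L_k(V)], [0 <= k <= n]. *)
Record Lbullet (V : lmodType D) := LBullet {
  L_val : {ffun 'I_n.+1 -> V};
  L_valP : L_val \in Lpred V }.

HB.instance Definition _ (V : lmodType D) := [isSub for @L_val V].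
HB.instance Definition _ (V : lmodType D) := [Choice of Lbullet V by <:].
HB.instance Definition _ (V : lmodType D) :=
  [SubChoice_isSubZmodule of Lbullet V by <:].

Definition Lcoord (V : lmodType D) (x : Lbullet V) (k : nat) : V :=
  L_val x (inord k).

Definition Lsingle (V : lmodType D) (k : nat) (v : V) : {ffun 'I_n.+1 -> V} :=
  [ffun j : 'I_n.+1 => if j == k :> nat then v else 0].

Definition Lbullet_deg (V : gmod (@Dplus_deg K q t n)) (d : nat) : set (Lbullet V) :=
  [set x | forall k, gm_deg d (L_val x k)].

Definition act_dp (k : nat) : D :=
  cst (q ^+ k) * X 1 * \prod_(1 <= i < k.+1) Tinv i.

Definition act_dm (k : nat) : D :=
  cst (q - 1) *
  \sum_(0 <= j < (n - k).+1) cst (q ^+ j) * \prod_(i <- rev (iota k j)) Tinv i.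

Definition Llmod (V : lmodType D) (m : GRing.Zmodule_isLmodule B (Lbullet V)) :
  lmodType B := HB.pack (Lbullet V) m.

(** A graded [B]-module structure on [L_bullet(V)], over the inherited addition,
    scalar multiplication and grading, with the prescribed generators action. *)
Record Lstruct (V : gmod (@Dplus_deg K q t n)) := LStruct {
  Ls_mixin : GRing.Zmodule_isLmodule B (Lbullet V);
  Ls_grading : is_grading (@Bn_deg K q t n) (V := Llmod Ls_mixin) (@Lbullet_deg V);
  Ls_act : B -> Lbullet V -> Lbullet V := fun b x => b *: (x : Llmod Ls_mixin);
  Ls_cst : forall c x k, L_val (Ls_act (bcst q t n c) x) k = cst c *: L_val x k;
  Ls_e : forall k x, (k <= n)%N ->
    L_val (Ls_act (be q t n k) x) = Lsingle k (Lcoord x k);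
  Ls_T : forall k i x, (k <= n)%N -> (0 < i < k)%N ->
    L_val (Ls_act (bT q t n k i) x) = Lsingle k (T i *: Lcoord x k);
  Ls_z : forall k i x, (k <= n)%N -> (0 < i <= k)%N ->
    L_val (Ls_act (bz q t n k i) x) =
      Lsingle k ((cst (q * t)^-1 * Y i) *: Lcoord x k);
  Ls_dp : forall k x, (k < n)%N ->
    L_val (Ls_act (bdp q t n k) x) = Lsingle k.+1 (act_dp k *: Lcoord x k);
  Ls_dm : forall k x, (0 < k <= n)%N ->
    L_val (Ls_act (bdm q t n k) x) = Lsingle k.-1 (act_dm k *: Lcoord x k) }.

Definition Lgmod (V : DMod) (S : Lstruct V) : BMod := GMod (Ls_grading S).

Lemma Lmap_subproof (U W : lmodType D) (f : {linear U -> W}) (x : Lbullet U) :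
  [ffun k => f (L_val x k)] \in Lpred W.
Proof.
apply/asboolP => k; rewrite ffunE; have /asboolP/(_ k)[v _ <-] := L_valP x.
by exists (f v); rewrite ?linearZ.
Qed.

Definition Lmap (U W : lmodType D) (f : {linear U -> W}) (x : Lbullet U) :
  Lbullet W := LBullet (Lmap_subproof f x).

End Lbullet.

Definition Qqt : fieldType := {fraction {poly {poly rat}}}.
Definition qvar : Qqt := tofrac (('X : {poly rat})%:P).
Definition tvar : Qqt := tofrac ('X : {poly {poly rat}}).

Notation DplusMod n := (gmodCat (@Dplus_deg Qqt qvar tvar n)).
Notation BnMod n := (gmodCat (@Bn_deg Qqt qvar tvar n)).

(* Main.v *)
Require Import Defs.
From HB Require Import structures.
From mathcomp Require Import all_boot all_order all_fingroup all_algebra.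
From mathcomp Require Import all_classical.
From mathcomp Require Import zify ring generic_quotient.
Set Implicit Arguments.
Unset Strict Implicit.
Unset Printing Implicit Defensive.
Import GRing.Theory Num.Theory.
Local Open Scope ring_scope.

(** Put L_k = 0 for k > n. The operators of the statement then satisfy all the
    relations of B_{q,t}, including those that involve vertices beyond n, so that
    the whole path algebra acts and one restricts to B^(n); no presentation of
    the subalgebra B^(n) is needed. With S_i = T_i^-1 and
    D_k = sum_j q^j S_(k+j-1) ... S_k, so that d_- = (q - 1) D_k and
    D_k = 1 + q D_(k+1) S_k, the relations rest on the following facts.
    - L_k consists of the X_1 ... X_k w with T_i w = w for i > k. This uses
      T_i eps_k = eps_k (Matsumoto's theorem), and that eps_k acts on such w by a
      nonzero scalar, a sum of powers of the transcendental q.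
    - phi = q^(k-1) X_1 S_1 ... S_(k-1) on L_k, for all 1 <= k <= n.
    - omega = Y_1 T_1 ... T_(n-1) satisfies omega X_i = X_(i+1) omega for i < n
      and, cancelling X_2 ... X_n, also omega X_n = t X_1 omega. Hence
      Y_i X_1 ... X_k = X_1 ... X_k U for some U, so that L_k is stable under Y_i.
    - (q - 1) D_k + 1 = q^(n-k+1) S_k ... S_(n-1) S_(n-1) ... S_k on L_k, which
      reduces the last relation to omega X_n = t X_1 omega. *)

(** * Reduced words in the symmetric group *)

Section Inversions.
Variable n : nat.
Implicit Types (s : 'S_n) (i : nat) (w : seq nat).

Definition inv_set s : {set 'I_n * 'I_n} :=
  [set p : 'I_n * 'I_n | (p.1 < p.2)%N && (s p.2 < s p.1)%N]%SET.

Definition ninv s : nat := #|inv_set s|.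

(** Products of permutations compose from left to right, so multiplying s by [stransp n i] on the
    left exchanges its values at the positions i - 1 and i, counted from 0. Quantifying over the
    positions makes the condition vacuous for i >= n. *)
Definition ascent i s := forall a b : 'I_n, a = i.-1 :> nat -> b = i :> nat ->
  (s a < s b)%N.

Lemma stranspE i (a b : 'I_n) :
  (0 < i)%N -> a = i.-1 :> nat -> b = i :> nat -> stransp n i = tperm a b.
Proof.
by move=> i0 ai bi; rewrite /stransp -ai -bi !valK.
Qed.

Lemma ord_pair i : (0 < i < n)%N ->
  exists a b : 'I_n, [/\ a = i.-1 :> nat, b = i :> nat & stransp n i = tperm a b].
Proof.
case/andP=> i0 i_n; have i1n : (i.-1 < n)%N by lia.
by exists (Ordinal i1n), (Ordinal i_n); split=> //; apply: stranspE.
Qed.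

Lemma stranspK i s : (stransp n i * (stransp n i * s) = s)%g.
Proof.
rewrite mulgA /stransp; case: insub => [a|]; last by rewrite !mul1g.
by case: insub => [b|]; rewrite ?tperm2 ?mul1g.
Qed.

Lemma stranspV i s s' : (s = stransp n i * s' -> stransp n i * s = s')%g.
Proof. by move->; rewrite stranspK. Qed.

Lemma stransp_commute i j : (0 < i < n)%N -> (0 < j < n)%N ->
  (i.+1 < j)%N || (j.+1 < i)%N -> commute (stransp n i) (stransp n j).
Proof.
move=> /ord_pair[a [b [ai bi ->]]] /ord_pair[c [d [cj dj ->]]] ij.
have [ac ad bc bd] : [/\ a != c, a != d, b != c & b != d].
  by rewrite -!val_eqE /=; split; lia.
rewrite /commute; apply/permP => x; rewrite !permM.
have H (u v : 'I_n) (p r : 'I_n) : u != p -> u != r -> v != p -> v != r ->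
   tperm p r (tperm u v x) = tperm u v (tperm p r x).
  move=> up ur vp vr; case: (tpermP u v x) => [->|->|/eqP xu /eqP xv].
  - by rewrite !(tpermD (x := p)) 1?eq_sym // tpermL.
  - by rewrite !(tpermD (x := p)) 1?eq_sym // tpermR.
  by case: (tpermP p r x) => _; rewrite tpermD // 1?eq_sym.
exact: H.
Qed.

(** As conjugates of transpositions, both sides equal the transposition of the letters i - 1 and i +
    1. *)
Lemma stransp_braid i : (0 < i)%N -> (i.+1 < n)%N ->
  (stransp n i * (stransp n i.+1 * stransp n i) =
   stransp n i.+1 * (stransp n i * stransp n i.+1))%g.
Proof.
move=> i0 i_n.
have h1 : (0 < i < n)%N by lia.
have h2 : (0 < i.+1 < n)%N by lia.
have [a [b [ai bi ->]]] := ord_pair h1.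
have [b' [c [bi' ci ->]]] := ord_pair h2.
have -> : b' = b by apply: val_inj; rewrite /= bi bi'.
have [ab ac bc] : [/\ a != b, a != c & b != c].
  by rewrite -!val_eqE /=; split; lia.
have -> : (tperm a b * (tperm b c * tperm a b))%g = tperm a c.
  by rewrite -[X in (X * _)%g]tpermV -[(_^-1 * _)%g]/(_ ^ _)%g tpermJ tpermR tpermD.
rewrite -[X in (X * _)%g]tpermV -[(_^-1 * _)%g]/(_ ^ _)%g tpermJ tpermL.
by rewrite tpermD // eq_sym.
Qed.

Lemma ninv_ascent i s : (0 < i < n)%N -> ascent i s ->
  ninv (stransp n i * s) = (ninv s).+1.
Proof.
move=> /[dup] iin /ord_pair[a [b [ai bi ->]]] /(_ a b ai bi) sab.
have ab : (a < b)%N by lia.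
(* The pair (a, b) is the only increasing pair whose order f reverses: f carries the inversions of s
   to the other inversions of the product, and (a, b) is a new one. *)
pose f (p : 'I_n * 'I_n) := (tperm a b p.1, tperm a b p.2).
have fK : involutive f by move=> [x y]; rewrite /f /= !tpermK.
rewrite /ninv; have -> : inv_set (tperm a b * s) = ((a, b) |: f @: inv_set s)%SET.
  apply/setP => -[x y]; rewrite in_setU1.
  have -> : ((x, y) \in f @: inv_set s) = (f (x, y) \in inv_set s).
    by rewrite -{1}(fK (x, y)) mem_imset //; apply: inv_inj.
  have tp u : [\/ u = a /\ tperm a b u = b, u = b /\ tperm a b u = a |
      [/\ (u != a :> nat), (u != b :> nat) & tperm a b u = u]].
    by case: tpermP => [->|->|/eqP ua /eqP ub]; [apply: Or31|apply: Or32|apply: Or33].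
  rewrite !inE /= !permM xpair_eqE -!val_eqE /=.
  by case: (tp x) => [[-> ->]|[-> ->]|[xa xb ->]];
     case: (tp y) => [[-> ->]|[-> ->]|[ya yb ->]]; lia.
rewrite cardsU1 card_imset; last exact: inv_inj.
rewrite (_ : (a, b) \notin _) //.
have -> : ((a, b) \in f @: inv_set s) = (f (a, b) \in inv_set s).
  by rewrite -{1}(fK (a, b)) mem_imset //; apply: inv_inj.
by rewrite inE /= tpermL tpermR; lia.
Qed.

Lemma ninv_descent i s : (0 < i < n)%N -> ~ ascent i s ->
  ninv s = (ninv (stransp n i * s)).+1.
Proof.
move=> iin Nasc; rewrite -{1}(stranspK i s) ninv_ascent //.
have [a [b [ai bi E]]] := ord_pair iin; rewrite E.
move=> a' b' ai' bi'.
have -> : a' = a by apply: val_inj; rewrite /= ai ai'.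
have -> : b' = b by apply: val_inj; rewrite /= bi bi'.
rewrite !permM tpermL tpermR ltnNge; apply/negP => sab; apply: Nasc.
move=> a'' b'' ai'' bi''.
have -> : a'' = a by apply: val_inj; rewrite /= ai ai''.
have -> : b'' = b by apply: val_inj; rewrite /= bi bi''.
rewrite ltn_neqAle sab andbT; apply/eqP => /val_inj/perm_inj E'.
move: iin (congr1 (@nat_of_ord n) E'); rewrite ai bi; lia.
Qed.

Lemma ninv1 : ninv 1 = 0%N.
Proof.
by apply/eqP; rewrite cards_eq0; apply/eqP/setP => -[a b]; rewrite !inE /= !perm1; lia.
Qed.

Lemma leq_ninv_word s w : expresses s w -> (ninv s <= size w)%N.
Proof.
elim: w s => [|i w IH] s [/= win ->]; first by rewrite big_nil ninv1.
case/andP: win => iin win; rewrite big_cons.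
have := IH _ (conj win erefl).
have [asc|Nasc] := pselect (ascent i (\prod_(j <- w) stransp n j)%g).
  by rewrite ninv_ascent.
by rewrite {1}(ninv_descent iin Nasc) /=; lia.
Qed.

(** Without a descent beyond k, s is increasing on the positions >= k; as it fixes the smaller ones,
    it is the identity. *)
Lemma exists_descent k s : s \in young n k -> s != 1%g ->
  exists i, (k < i < n)%N /\ ~ ascent i s.
Proof.
rewrite inE => /forallP sk s1; apply: contrapT => noD.
have asc (a b : 'I_n) : b = a.+1 :> nat -> (k <= a)%N -> (s a < s b)%N.
  move=> ba ka; have [//|Nsab] := pselect (s a < s b)%N.
  case: noD; exists b; split; first by have := ltn_ord b; lia.
  by move=> H; apply: Nsab; apply: H; rewrite ?ba.
have incr d (a b : 'I_n) : (k <= a)%N -> b = (a + d.+1)%N :> nat -> (s a < s b)%N.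
  elim: d b => [|d IH] b ka ba; first by apply: asc; rewrite // ba addn1.
  have c_n : (a + d.+1 < n)%N by have := ltn_ord b; lia.
  apply: ltn_trans (IH (Ordinal c_n) ka erefl) _.
  by apply: asc => /=; lia.
case/negP: s1; apply/eqP/permP => a; rewrite perm1.
have [m] := ubnP (nat_of_ord a); elim: m a => // m IH a am.
have [ak|ka] := ltnP a k; first by have /implyP/(_ ak)/eqP := sk a.
(* If b < a, induction gives s b = b, which contradicts s b = a. If a < b, monotonicity gives s a <
   a, and induction makes s a a fixed point, so that s a = a by injectivity. *)
have [b sb] : exists b, s b = a by exists ((s^-1)%g a); rewrite permKV.
have [ba|ab|/val_inj ba] := ltngtP b a; last by rewrite -{1}ba.
- have := IH b; rewrite sb => E; have /E ab : (b < m)%N by lia.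
  by move: ba; rewrite ab ltnn.
- have := incr (b - a).-1 a b ka; rewrite sb => H.
  have {H}sa : (s a < a)%N by apply: H; lia.
  have /perm_inj /(congr1 val) /= := IH (s a) ltac:(lia).
  by lia.
Qed.

Lemma young_stransp i k s : (k < i < n)%N ->
  (stransp n i * s \in young n k)%g = (s \in young n k).
Proof.
move=> /andP[ki i_n]; have iin : (0 < i < n)%N by lia.
have H s' : (s' \in young n k) -> (stransp n i * s' \in young n k)%g.
  rewrite !inE => /forallP sk; apply/forallP => j; apply/implyP => jk.
  have [a [b [ai bi ->]]] := ord_pair iin.
  rewrite permM tpermD; first by have /implyP := sk j; apply.
    by rewrite -val_eqE /=; lia.
  by rewrite -val_eqE /=; lia.
by apply/idP/idP => /H; rewrite ?stranspK.
Qed.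

(** Descents beyond k are stripped one at a time; each lowers the number of inversions by one and
    stays inside the Young subgroup. *)
Lemma young_word k s : s \in young n k ->
  exists w, [/\ expresses s w, size w = ninv s & all (fun i => k < i)%N w].
Proof.
have [m] := ubnP (ninv s); elim: m s => // m IH s sm sk.
have [->|s1] := eqVneq s 1%g.
  by exists [::]; split=> //; [split; rewrite ?big_nil | rewrite ninv1].
have [i [ik Nasc]] := exists_descent sk s1.
have iin : (0 < i < n)%N by lia.
have E := ninv_descent iin Nasc.
have [||w [[win wE] wsz wk]] := IH (stransp n i * s)%g; first by lia.
  by rewrite young_stransp.
exists (i :: w); split; first split.
- by rewrite /= iin.
- by rewrite big_cons -wE stranspK.
- by rewrite /= wsz E.
by rewrite /= wk; lia.
Qed.

Lemma young0 s : s \in young n 0.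
Proof. by rewrite inE; apply/forallP. Qed.

Lemma redwordP s : expresses s (redword s) /\ size (redword s) = ninv s.
Proof.
have [w [ws wsz _]] := young_word (young0 s).
have : reduced_expr s (redword s).
  apply: (@xgetPex _ [::] [set w | reduced_expr s w]%classic); exists w.
  by split=> // w' /leq_ninv_word; rewrite wsz.
move=> [e me]; split=> //; apply/eqP; rewrite eqn_leq leq_ninv_word // andbT.
by rewrite -wsz me.
Qed.

Lemma plengthE s : plength s = ninv s.
Proof. by have [] := redwordP s. Qed.

Lemma reduced_cons i s w : expresses s (i :: w) -> ninv s = (size w).+1 ->
  [/\ (0 < i < n)%N, ~ ascent i s, expresses (stransp n i * s)%g w
    & ninv (stransp n i * s)%g = size w].
Proof.
move=> [/= /andP[iin win] sE] sz; move: sE; rewrite big_cons => /stranspV sE.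
have ew : expresses (stransp n i * s)%g w by [].
have le := leq_ninv_word ew.
have Nasc : ~ ascent i s by move=> asc; have := ninv_ascent iin asc; lia.
by split=> //; have := ninv_descent iin Nasc; lia.
Qed.

(** * Matsumoto's theorem: products over reduced words *)

Section Matsumoto.
Variables (A : pzRingType) (T : nat -> A).
Hypothesis braid : forall i, (0 < i)%N -> (i.+1 < n)%N ->
  T i * (T i.+1 * T i) = T i.+1 * (T i * T i.+1).
Hypothesis far : forall i j, (0 < i < n)%N -> (0 < j < n)%N -> (i.+1 < j)%N ->
  T i * T j = T j * T i.

Local Notation Tw w := (\prod_(i <- w) T i).

(** The values of s at three consecutive positions decrease, and each of the three multiplications
    undoes one of the inversions among them. *)
Lemma adjacent_descents i s : (0 < i)%N -> (i.+1 < n)%N ->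
  ~ ascent i s -> ~ ascent i.+1 s ->
  ninv s = (ninv (stransp n i.+1 * (stransp n i * s)))%g.+2 /\
  ninv s = (ninv (stransp n i * (stransp n i.+1 * (stransp n i * s))))%g.+3.
Proof.
move=> i0 i_n Ni Nj.
have h1 : (0 < i < n)%N by lia.
have h2 : (0 < i.+1 < n)%N by lia.
have [a [b [ai bi Ei]]] := ord_pair h1.
have [b' [c [bi' ci Ej]]] := ord_pair h2.
have bb : b' = b by apply: val_inj; rewrite /= bi bi'.
rewrite {}bb in Ej bi'.
have sba : (s b <= s a)%N.
  rewrite leqNgt; apply/negP => sab; apply: Ni => x y xi yi.
  have -> : x = a by apply: val_inj; rewrite /= ai xi.
  by have -> : y = b by apply: val_inj; rewrite /= bi yi.
have scb : (s c <= s b)%N.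
  rewrite leqNgt; apply/negP => sab; apply: Nj => x y xi yi.
  have -> : x = b by apply: val_inj; rewrite /= bi' xi.
  by have -> : y = c by apply: val_inj; rewrite /= ci yi.
have E1 := ninv_descent h1 Ni.
have [ab ac bc] : [/\ a != b, a != c & b != c].
  by rewrite -!val_eqE /=; split; lia.
have N2 : ~ ascent i.+1 (stransp n i * s)%g.
  move=> /(_ b c bi' ci); rewrite Ei !permM tpermR tpermD //.
  by move=> H; have := leq_trans H scb; lia.
have N3 : ~ ascent i (stransp n i.+1 * (stransp n i * s))%g.
  move=> /(_ a b ai bi); rewrite Ei Ej !permM tpermL (tpermD (z := a)) 1?eq_sym //.
  by rewrite tpermL tpermD // ltnNge scb.
have := ninv_descent h2 N2; have := ninv_descent h1 N3; lia.
Qed.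

(** Two reduced words of [s] starting with different letters are both related
    to a reduced word starting with the longest element of the dihedral
    parabolic subgroup that these letters generate. *)
Lemma matsumoto s w w' : expresses s w -> expresses s w' ->
  size w = ninv s -> size w' = ninv s -> Tw w = Tw w'.
Proof.
have [m] := ubnP (ninv s); elim: m s w w' => // m IH s.
case=> [|i u] [|j u'] //=; [by move=> _ _ _ <-|by move=> _ _ _ + E; rewrite -E|].
move=> sm ew ew' sw sw'.
have [iin Ni eu nu] := reduced_cons ew (esym sw).
have [jjn Nj eu' nu'] := reduced_cons ew' (esym sw').
rewrite !big_cons.
have sub r r' s' : (ninv s' < ninv s)%N -> expresses s' r -> expresses s' r' ->
    size r = ninv s' -> size r' = ninv s' -> Tw r = Tw r'.
  by move=> s's; apply: IH; lia.
wlog ij : i j u u' {ew ew'} iin jjn Ni Nj eu eu' nu nu' sw sw' / (i <= j)%N.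
  by move=> H; have [/H|/ltnW/H] := leqP i j; [apply|move=> E; apply/esym/E].
have [eij|nij] := eqVneq i j.
  subst j; congr (_ * _); apply: sub eu eu' _ _; lia.
have [ij1|ij1] := eqVneq j i.+1.
  subst j; have i0 : (0 < i)%N by lia.
  have i_n : (i.+1 < n)%N by lia.
  have [e2 e3] := adjacent_descents i0 i_n Ni Nj.
  have [r [[rin er] sr _]] :=
    young_word (young0 (stransp n i * (stransp n i.+1 * (stransp n i * s)))).
  rewrite (sub u (i.+1 :: i :: r) (stransp n i * s)%g) //; first last.
  - by rewrite /= sr; lia.
  - by split; [rewrite /= iin i_n|rewrite !big_cons -er !stranspK].
  - by lia.
  rewrite (sub u' (i :: i.+1 :: r) (stransp n i.+1 * s)%g) //; first last.
  - by rewrite /= sr; lia.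
  - split; first by rewrite /= iin i_n.
    rewrite !big_cons -er.
    by rewrite (mulgA (stransp n i.+1)) mulgA stransp_braid // -!mulgA !stranspK.
  - by lia.
  by rewrite !big_cons 2!mulrA -(mulrA (T i)) braid // !mulrA.
have ij2 : (i.+1 < j)%N by lia.
have C := stransp_commute iin jjn; rewrite ij2 in C; have {}C := C isT.
have Nij : ~ ascent j (stransp n i * s)%g.
  move: Nj; have [a [b [ai bi Ei]]] := ord_pair iin.
  have [c [d [cj dj _]]] := ord_pair jjn => Nj asc; apply: Nj => c' d' cj' dj'.
  have := asc c' d' cj' dj'; rewrite Ei !permM !tpermD // -val_eqE /=; lia.
have e2 := ninv_descent jjn Nij.
have [r [[rin er] sr _]] := young_word (young0 (stransp n j * (stransp n i * s))).
rewrite (sub u (j :: r) (stransp n i * s)%g) //; first last.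
- by rewrite /= sr; lia.
- by split; [rewrite /= jjn|rewrite !big_cons -er !stranspK].
- by lia.
rewrite (sub u' (i :: r) (stransp n j * s)%g) //; first last.
- by rewrite /= sr; lia.
- split; first by rewrite /= iin.
  by rewrite big_cons -er mulgA C -mulgA stranspK.
- by lia.
by rewrite !big_cons !mulrA far.
Qed.

Lemma Tw_redword_ascent i s : (0 < i < n)%N -> ascent i s ->
  Tw (redword (stransp n i * s)%g) = T i * Tw (redword s).
Proof.
move=> iin asc; have [[sw es] ss] := redwordP s.
have [e' s'] := redwordP (stransp n i * s)%g.
transitivity (Tw (i :: redword s)); last by rewrite big_cons.
apply: (matsumoto e') => //; last by rewrite /= ss ninv_ascent.
by split; [rewrite /= iin | rewrite big_cons -es].
Qed.

(** Nothing is known about the letters of the chosen word [redword s]; Matsumoto's theorem trades it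
    for one with all letters beyond k. *)
Lemma young_redword k s : s \in young n k ->
  exists2 w, Tw (redword s) = Tw w & all (fun i => k < i < n)%N w.
Proof.
move=> /young_word[w [ew sw kw]]; have [es ss] := redwordP s.
exists w; first exact: matsumoto es ew ss sw.
by case: ew => nw _; apply/allP => i iw; move/allP/(_ i iw): kw;
  move/allP/(_ i iw): nw; lia.
Qed.
End Matsumoto.

End Inversions.

Lemma commr_prod_nat (R : pzSemiRingType) (x : R) (F : nat -> R) a b :
  (forall i, (a <= i < b)%N -> GRing.comm x (F i)) ->
  GRing.comm x (\prod_(a <= i < b) F i).
Proof. by move=> xF; rewrite big_nat; apply: commr_prod => i /xF. Qed.

Lemma commr_prod_seq (R : pzSemiRingType) (x : R) (F : nat -> R) (r : seq nat) :
  (forall i, i \in r -> GRing.comm x (F i)) -> GRing.comm x (\prod_(i <- r) F i).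
Proof. by move=> xF; rewrite big_seq; apply: commr_prod => i /xF. Qed.

Lemma rev_iotaS k j : rev (iota k j.+1) = (k + j)%N :: rev (iota k j).
Proof. by rewrite -rev_rcons -cats1 -[X in _ ++ X]/(iota (k + j) 1) -iotaD addn1. Qed.

(** * Identities in the positive double affine Hecke algebra *)

Section PositiveDAHA.
Variables (K : fieldType) (q t : K) (n : nat).
Local Notation D := (Dplus q t n).
Local Notation A := (palg (daha_rel q t n)).
Local Notation T := (dT q t n).
Local Notation X := (dX q t n).
Local Notation Y := (dY q t n).
Local Notation Tinv := (dTinv q t n).
Local Notation cst := (dcst q t n).
Local Notation act_dp := (act_dp q t n).
Local Notation act_dm := (act_dm q t n).
Local Notation XX k := (\prod_(1 <= i < k.+1) X i).

Lemma cst_is_zmod_morphism : zmod_morphism (dcst q t n).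
Proof.
move=> a b; apply: val_inj; rewrite /= !mulr1; apply/eqP.
by rewrite -subr_eq opprK -pcstD subrK.
Qed.

Lemma cst_is_monoid_morphism : monoid_morphism (dcst q t n).
Proof.
split=> [|a b]; apply: val_inj; first by rewrite /= mulr1.
by rewrite /= !mulr1 pcstM.
Qed.

HB.instance Definition _ :=
  GRing.isZmodMorphism.Build K D (dcst q t n) cst_is_zmod_morphism.
HB.instance Definition _ :=
  GRing.isMonoidMorphism.Build K D (dcst q t n) cst_is_monoid_morphism.

Lemma cstC c (x : D) : x * cst c = cst c * x.
Proof. by apply: val_inj; rewrite /= !mulr1 pcstC. Qed.

Lemma cstCA c (x y : D) : x * (cst c * y) = cst c * (x * y).
Proof. by rewrite mulrA cstC mulrA. Qed.

Lemma cstMM c d (x : D) : cst c * (cst d * x) = cst (c * d) * x.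
Proof. by rewrite rmorphM mulrA. Qed.

Lemma pcstN x : pcst (daha_rel q t n) (-1) * x = - x.
Proof.
rewrite -[RHS]mulN1r; congr (_ * _); apply/eqP; rewrite -addr_eq0.
by rewrite -[X in _ + X](pcst1 (daha_rel q t n)) -pcstD addNr.
Qed.

(** * Defining relations, read inside the positive part *)

Lemma daha_relE x y : daha_rel q t n x y ->
  pcls (daha_rel q t n) x = pcls (daha_rel q t n) y.
Proof. by move=> xy; apply/pclsP/pc_rel. Qed.

Lemma dT_quad i : (0 < i < n)%N -> (T i - 1) * (T i + cst q) = 0.
Proof.
move=> h; apply: val_inj; move: (daha_relE (dr_quad q t h)).
by rewrite !(pclsM, pclsD) ?pcstN /= ?mulr1 ?mulrA.
Qed.

Lemma dT_braid i : (0 < i)%N -> (i.+1 < n)%N ->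
  T i * (T i.+1 * T i) = T i.+1 * (T i * T i.+1).
Proof.
move=> h h'; apply: val_inj; move: (daha_relE (dr_braid q t h h')).
by rewrite !(pclsM, pclsD) ?pcstN /= ?mulr1 ?mulrA.
Qed.

Lemma dT_comm i j : (0 < i < n)%N -> (0 < j < n)%N -> (i.+1 < j)%N || (j.+1 < i)%N ->
  GRing.comm (T i) (T j).
Proof.
move=> h h' ij; apply: val_inj; move: (daha_relE (dr_TT q t h h' ij)).
by rewrite !(pclsM, pclsD) ?pcstN /= ?mulr1 ?mulrA.
Qed.

Lemma dTX_comm i j : (0 < i < n)%N -> (0 < j <= n)%N -> j != i -> j != i.+1 ->
  GRing.comm (T i) (X j).
Proof.
move=> h h' ij ij'; apply: val_inj; move: (daha_relE (dr_TX q t h h' ij ij')).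
by rewrite !(pclsM, pclsD) ?pcstN /= ?mulr1 ?mulrA.
Qed.

Lemma dTY_comm i j : (0 < i < n)%N -> (0 < j <= n)%N -> j != i -> j != i.+1 ->
  GRing.comm (T i) (Y j).
Proof.
move=> h h' ij ij'; apply: val_inj; move: (daha_relE (dr_TY q t h h' ij ij')).
by rewrite !(pclsM, pclsD) ?pcstN /= ?mulr1 ?mulrA.
Qed.

Lemma dX_comm i j : (0 < i <= n)%N -> (0 < j <= n)%N -> GRing.comm (X i) (X j).
Proof.
move=> h h'; apply: val_inj; move: (daha_relE (dr_XX q t h h')).
by rewrite !(pclsM, pclsD) ?pcstN /= ?mulr1 ?mulrA.
Qed.

Lemma dY_comm i j : (0 < i <= n)%N -> (0 < j <= n)%N -> GRing.comm (Y i) (Y j).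
Proof.
move=> h h'; apply: val_inj; move: (daha_relE (dr_YY q t h h')).
by rewrite !(pclsM, pclsD) ?pcstN /= ?mulr1 ?mulrA.
Qed.

Lemma dTXT i : (0 < i < n)%N -> Tinv i * X i * Tinv i = cst q^-1 * X i.+1.
Proof.
move=> h; apply: val_inj; move: (daha_relE (dr_TXT q t h)).
by rewrite !(pclsM, pclsD) ?pcstN /= ?mulr1 ?mulrA.
Qed.

Lemma dTYT i : (0 < i < n)%N -> T i * Y i * T i = cst q * Y i.+1.
Proof.
move=> h; apply: val_inj; move: (daha_relE (dr_TYT q t h)).
by rewrite !(pclsM, pclsD) ?pcstN /= ?mulr1 ?mulrA.
Qed.

Lemma dYTX : (1 < n)%N -> Y 1 * T 1 * X 1 = X 2 * Y 1 * T 1.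
Proof.
move=> h; apply: val_inj; move: (daha_relE (dr_YTX q t h)).
by rewrite !(pclsM, pclsD) ?pcstN /= ?mulr1 ?mulrA.
Qed.

Lemma dprodXE : pcls (daha_rel q t n) (dprodX K n) = val (\prod_(1 <= i < n.+1) X i).
Proof.
rewrite /dprodX /index_iota subSS subn0; elim: (iota 1 n) => [|i w IH].
  by rewrite big_nil.
by rewrite big_cons /= pclsM IH.
Qed.

Lemma dYX : (0 < n)%N ->
  Y 1 * \prod_(1 <= i < n.+1) X i = cst t * (\prod_(1 <= i < n.+1) X i * Y 1).
Proof.
move=> h; apply: val_inj; have /pclsP := pc_rel (dr_YX q t h).
by rewrite !(pclsM, pclsD) dprodXE /= mulr1.
Qed.

(** The inverse of X_i exists in the ambient algebra only; in the positive part, cancellation takes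
    its place. *)
Lemma dX_lreg i : (0 < i <= n)%N -> GRing.lreg (X i).
Proof.
move=> h x y /(congr1 val) /= E; apply: val_inj.
have /pclsP := pc_rel (dr_Xinv_l q t h); rewrite pclsM => XK.
by rewrite -[LHS]mul1r -[RHS]mul1r -[1]XK -!mulrA; congr (_ * _).
Qed.

Lemma cstVK c (x : D) : c != 0 -> cst c^-1 * (cst c * x) = x.
Proof. by move=> c0; rewrite cstMM mulVf // rmorph1 mul1r. Qed.

Lemma cst_inj c (x y : D) : c != 0 -> cst c * x = cst c * y -> x = y.
Proof. by move=> c0 /(congr1 ( *%R (cst c^-1))); rewrite !cstVK. Qed.

(** [dTinv] unfolds to a product, which [mulrA] would otherwise see. *)
Definition dS (i : nat) : D := locked (Tinv i).

Local Notation S := dS.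
Local Notation P k := (\prod_(1 <= i < k.+1) S i).
Local Notation Q k := (\prod_(1 <= i < k.+1) S i.+1).

Lemma dTinv_dS i : Tinv i = S i.
Proof. exact: lock. Qed.

Lemma commS x i : GRing.comm x (T i) -> GRing.comm x (S i).
Proof.
move=> xT; rewrite -dTinv_dS; apply: GRing.commrM; first exact/cstC.
by apply: GRing.commrD => //; apply/cstC.
Qed.

Lemma dST i j : (0 < i < n)%N -> (0 < j < n)%N -> (i.+1 < j)%N || (j.+1 < i)%N ->
  GRing.comm (S i) (T j).
Proof. by move=> hi hj ij; apply/esym/commS/dT_comm; rewrite // orbC. Qed.

Lemma comm_prodS k x : (forall i, (0 < i <= k)%N -> GRing.comm x (T i)) ->
  GRing.comm x (P k).
Proof.
by move=> xT; apply: commr_prod_nat => i ik; apply/commS/xT; lia.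
Qed.

(** T_i moves left past F_k, ..., F_(i+2), becomes T_(i+1) on crossing F_i F_(i+1), and then passes
    the remaining factors. The family F is instantiated by the T_i and by their inverses. *)
Lemma shift_prod (F : nat -> D) :
    (forall i x, (0 < i)%N -> (i.+1 < n)%N ->
      F i * (F i.+1 * (T i * x)) = T i.+1 * (F i * (F i.+1 * x))) ->
    (forall i j, (0 < i < n)%N -> (0 < j < n)%N -> (i.+1 < j)%N || (j.+1 < i)%N ->
      GRing.comm (F i) (T j)) ->
  forall k i x, (0 < i < k)%N -> (k < n)%N ->
  \prod_(1 <= j < k.+1) F j * (T i * x) = T i.+1 * (\prod_(1 <= j < k.+1) F j * x).
Proof.
move=> Fbraid Ffar; elim=> [|k IH] i x; first by lia.
move=> /andP[i0 ik] k_n; rewrite big_nat_recr //= -mulrA.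
have [{}ik|ki] := ltnP i k; last first.
  have {ik ki} ? : i = k by lia.
  subst i; case: k k_n i0 {IH} => [|k] k_n // _.
  rewrite big_nat_recr //= -!mulrA Fbraid; try lia.
  rewrite mulrA [RHS]mulrA; congr (_ * _); apply/esym.
  by apply: commr_prod_nat => j jk; apply/esym/Ffar; lia.
rewrite (mulrA _ (T i)) Ffar; try lia.
by rewrite -mulrA IH; try lia; rewrite -!mulrA.
Qed.

Lemma shift_prodT k i x : (0 < i < k)%N -> (k < n)%N ->
  \prod_(1 <= j < k.+1) T j * (T i * x) = T i.+1 * (\prod_(1 <= j < k.+1) T j * x).
Proof.
apply: shift_prod => [j y j0 jn|j l ? ? ?]; last exact: dT_comm.
by rewrite !mulrA -(mulrA (T j)) dT_braid // !mulrA.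
Qed.

Definition dD a : D :=
  \sum_(0 <= j < (n - a).+1) cst (q ^+ j) * \prod_(i <- rev (iota a j)) S i.

Lemma dD_n : dD n = 1.
Proof. by rewrite /dD subnn big_nat1 big_nil mulr1 expr0 rmorph1. Qed.

Lemma dD_rec a : (a < n)%N -> dD a = 1 + cst q * (dD a.+1 * S a).
Proof.
move=> a_n; rewrite /dD; have -> : (n - a = (n - a.+1).+1)%N by lia.
rewrite big_nat_recl // big_nil mulr1 expr0 rmorph1; congr (_ + _).
rewrite mulr_suml mulr_sumr; apply: eq_bigr => j _.
by rewrite /= rev_cons big_rcons /= exprS rmorphM -!mulrA.
Qed.

Lemma dD_comm a x : (a <= n)%N ->
  (forall i, (a <= i < n)%N -> GRing.comm x (T i)) -> GRing.comm x (dD a).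
Proof.
move=> a_n xT; rewrite /dD big_nat; apply: commr_sum => j ja.
apply: commrM; first exact: cstC.
rewrite big_seq; apply: commr_prod => i; rewrite mem_rev mem_iota => ij.
by apply/commS/xT; lia.
Qed.

Lemma act_dmE k : act_dm k = cst (q - 1) * dD k.
Proof.
rewrite /Defs.act_dm /dD; congr (_ * _); apply: eq_bigr => j _; congr (_ * _).
by apply: eq_bigr => i _; rewrite dTinv_dS.
Qed.

Lemma act_dpE k : act_dp k = cst (q ^+ k) * (X 1 * P k).
Proof.
by rewrite /Defs.act_dp -mulrA; congr (_ * (_ * _)); apply: eq_bigr => i _; rewrite dTinv_dS.
Qed.

(** The closed form of varphi at the vertex k; [dphiE] and [dphi_n] identify it with the
    commutator. *)
Definition dphi k : D := cst (q ^+ k.-1) * (X 1 * P k.-1).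

Lemma comm_dD_X1P a k : (k.+1 < a <= n)%N -> dD a * (X 1 * P k) = X 1 * P k * dD a.
Proof.
move=> ka; apply/esym/dD_comm => [|i ia]; first by lia.
apply/esym/commrM; first by apply: dTX_comm; lia.
by apply: comm_prodS => j jk; apply: dT_comm; lia.
Qed.

Lemma dp_dm k : (0 < k <= n)%N ->
  act_dp k.-1 * act_dm k = cst (q - 1) * (dphi k * dD k).
Proof. by move=> _; rewrite act_dpE act_dmE /dphi cstCA -!mulrA. Qed.

(** The last factor S_k of d_+ is kept to the right of D_(k+1), so that subtracting this from
    [dp_dm] leaves phi (D_k - q D_(k+1) S_k), which is phi by [dD_sub]. *)
Lemma dm_dp k : (0 < k < n)%N ->
  act_dm k.+1 * act_dp k = cst (q - 1) * (cst q * (dphi k * (dD k.+1 * S k))).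
Proof.
case: k => // k k_n; rewrite act_dpE act_dmE /dphi -mulrA; congr (_ * _).
rewrite cstCA big_nat_recr //= [X 1 * _]mulrA [dD _ * _]mulrA comm_dD_X1P; last by lia.
by rewrite exprS -cstMM -!mulrA.
Qed.

Lemma prodS_recl k : P k.+1 = S 1 * \prod_(1 <= i < k.+1) S i.+1.
Proof. by rewrite big_nat_recl. Qed.

Lemma TYT i x : (0 < i < n)%N -> T i * (Y i * (T i * x)) = cst q * (Y i.+1 * x).
Proof. by move=> h; rewrite !mulrA dTYT. Qed.

Lemma XX2 : XX 2 = X 1 * X 2.
Proof. by rewrite big_ltn // big_nat1. Qed.

(** Locked, like [dS], so that reassociation treats it as a single factor. *)
Definition domega : D := locked (Y 1 * \prod_(1 <= i < n) T i).

Lemma domegaE : domega = Y 1 * \prod_(1 <= i < n) T i.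
Proof. by rewrite /domega -lock. Qed.

Lemma omega_T i : (0 < i)%N -> (i.+1 < n)%N -> domega * T i = T i.+1 * domega.
Proof.
move=> i0 i_n; rewrite domegaE -mulrA; have h : (0 < i < n.-1)%N by lia.
have := @shift_prodT n.-1 i 1 h; rewrite !mulr1 prednK; last by lia.
by move=> ->; [rewrite !mulrA dTY_comm //; lia | lia].
Qed.

Lemma dXX_lreg k : (k <= n)%N -> GRing.lreg (XX k).
Proof.
elim: k => [|k IH] k_n; first by rewrite big_nil; apply: lreg1.
rewrite big_nat_recr //=; apply: lregM; first by apply: IH; lia.
by apply: dX_lreg; lia.
Qed.

Lemma dXshift_lreg k : (k < n)%N -> GRing.lreg (\prod_(1 <= i < k.+1) X i.+1).
Proof.
elim: k => [|k IH] k_n; first by rewrite big_nil; apply: lreg1.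
rewrite big_nat_recr //=; apply: lregM; first by apply: IH; lia.
by apply: dX_lreg; lia.
Qed.

Lemma prodX_rot k : (0 < k <= n)%N -> \prod_(1 <= i < k) X i.+1 * X 1 = XX k.
Proof.
case: k => // k k_n; rewrite [RHS]big_nat_recl //.
apply/esym/commr_prod_nat => i ik; apply: dX_comm; lia.
Qed.

Lemma prodS_full k : (0 < k <= n)%N -> P k.-1 * \prod_(k <= i < n) S i = P n.-1.
Proof.
move=> k_n; rewrite !prednK; try lia.
by rewrite -big_cat_nat //; lia.
Qed.

Lemma act_dm_comm k x : (0 < k <= n)%N ->
  (forall i, (k <= i < n)%N -> GRing.comm x (T i)) -> x * act_dm k = act_dm k * x.
Proof.
move=> k_n xT; rewrite act_dmE cstCA -[RHS]mulrA; congr (_ * _).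
by apply: dD_comm => //; lia.
Qed.

(** * Inverses of the T_i, and relations between the operators *)

Hypothesis q0 : q != 0.

Lemma dTinvE i : cst q * S i = T i + cst (q - 1).
Proof. by rewrite -dTinv_dS cstMM mulfV // rmorph1 mul1r. Qed.

Lemma dTT i : (0 < i < n)%N -> T i * T i = cst q - cst (q - 1) * T i.
Proof.
move=> h; apply/eqP; rewrite -subr_eq0 -(dT_quad h) rmorphB rmorph1.
by rewrite mulrDr !mulrBl !mul1r cstC opprB addrACA -!addrA.
Qed.

Lemma dTK i : (0 < i < n)%N -> T i * S i = 1.
Proof.
move=> h; apply: (cst_inj q0); rewrite -cstCA dTinvE mulr1 mulrDr cstC.
by rewrite dTT // subrK.
Qed.

Lemma dSK i : (0 < i < n)%N -> S i * T i = 1.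
Proof.
move=> h; rewrite -[RHS](dTK h) -dTinv_dS /dTinv -mulrA cstCA; congr (_ * _).
by rewrite mulrDl mulrDr cstC.
Qed.

Lemma dTVK i x : (0 < i < n)%N -> T i * (S i * x) = x.
Proof. by move=> h; rewrite mulrA dTK // mul1r. Qed.

Lemma dSVK i x : (0 < i < n)%N -> S i * (T i * x) = x.
Proof. by move=> h; rewrite mulrA dSK // mul1r. Qed.

Lemma dSST i x : (0 < i)%N -> (i.+1 < n)%N ->
  S i * (S i.+1 * (T i * x)) = T i.+1 * (S i * (S i.+1 * x)).
Proof.
move=> i0 i_n; have h : (0 < i < n)%N by lia.
have h' : (0 < i.+1 < n)%N by lia.
set y := S i * (S i.+1 * x).
(* With x in this form, the claim is the braid relation followed by cancellations. *)
have -> : x = T i.+1 * (T i * y) by rewrite !dTVK.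
rewrite (mulrA (T i.+1)) (mulrA (T i)) dT_braid //.
by rewrite -!mulrA !dSVK.
Qed.

Lemma dSSS i x : (0 < i)%N -> (i.+1 < n)%N ->
  S i * (S i.+1 * (S i * x)) = S i.+1 * (S i * (S i.+1 * x)).
Proof.
move=> i0 i_n; have h : (0 < i < n)%N by lia.
have h' : (0 < i.+1 < n)%N by lia.
by rewrite -[LHS](dSVK _ h') -dSST // dTVK.
Qed.

Lemma dSX i x : (0 < i < n)%N -> S i * (X i * x) = cst q^-1 * (X i.+1 * (T i * x)).
Proof.
move=> h; rewrite (mulrA (X _)) (mulrA (cst _)) (mulrA (cst _)) -dTXT // dTinv_dS.
by rewrite -!mulrA dSVK.
Qed.

Lemma dXS i x : (0 < i < n)%N -> X i * (S i * x) = cst q^-1 * (T i * (X i.+1 * x)).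
Proof.
by move=> h; rewrite -cstCA [cst _ * _]mulrA -dTXT // dTinv_dS -!mulrA dTVK.
Qed.

Lemma shift_prodS k i x : (0 < i < k)%N -> (k < n)%N ->
  P k * (T i * x) = T i.+1 * (P k * x).
Proof. by apply: shift_prod => *; [apply: dSST | apply: dST]. Qed.

Lemma shift_prodSS k i x : (0 < i < k)%N -> (k < n)%N ->
  P k * (S i * x) = S i.+1 * (P k * x).
Proof.
move=> ik k_n; rewrite -[LHS](@dSVK i.+1); last by lia.
by rewrite -shift_prodS // dTVK //; lia.
Qed.

(** Since q S_i = T_i + q - 1, the first factor is T_i + q, and this is the quadratic relation. *)
Lemma symm_annihilates i : (0 < i < n)%N -> (1 + cst q * S i) * (T i - 1) = 0.
Proof.
move=> h; rewrite mulrDl mul1r -mulrA mulrBr mulr1 dSK // mulrBr mulr1 dTinvE.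
rewrite rmorphB rmorph1 opprD opprB 2![cst q + _]addrCA subrr addr0.
by rewrite addrACA subrr addNr addr0.
Qed.

(** This yields d_-^2 T_(k-1) = d_-^2. Expanding D_a, then the second D_(a+1), splits the product
    into D_(a+1) (1 + q S_a) (T_a - 1), which vanishes by [symm_annihilates], and a multiple of
    D_(a+1) D_(a+2) (T_(a+1) - 1) S_a S_(a+1), which vanishes by induction. *)
Lemma dDD_annihilates a : (0 < a < n)%N -> dD a * (dD a.+1 * (T a - 1)) = 0.
Proof.
have [m] := ubnP (n - a); elim: m a => // m IH a am h.
rewrite dD_rec; last by lia.
have [a1n|a1n] := eqVneq a.+1 n; first by rewrite a1n dD_n !mul1r symm_annihilates.
have SD : S a * dD a.+1 = S a + cst q * (dD a.+2 * (S a * S a.+1)).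
  rewrite (@dD_rec a.+1); last by lia.
  rewrite mulrDr mulr1 cstCA; congr (_ + _ * _).
  rewrite mulrA [RHS]mulrA; congr (_ * _).
  by apply: dD_comm => [|i ia]; [lia | apply: dST; lia].
rewrite mulrDl mul1r -!mulrA [S a * _]mulrA SD mulrDl mulrDr.
rewrite -!mulrA; have -> : S a * (S a.+1 * (T a - 1)) = (T a.+1 - 1) * (S a * S a.+1).
  by have := @dSST a 1; rewrite !mulr1 !mulrBr !mulr1 mulrBl mul1r => -> //; lia.
rewrite mulrDr cstCA [dD a.+2 * _]mulrA [dD a.+1 * (_ * _ * _)]mulrA IH; try lia.
rewrite mul0r !mulr0 addr0 -cstCA -mulrDr -[X in _ * (X + _)]mul1r [cst q * _]mulrA.
by rewrite -mulrDl symm_annihilates ?mulr0.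
Qed.

Lemma dD_sub k : (k < n)%N -> dD k - cst q * (dD k.+1 * S k) = 1.
Proof. by move=> k_n; rewrite dD_rec // addrK. Qed.

(** T_(k-1) cancels the last factor of [dphi k]; what remains commutes with D_k. *)
Lemma dphi_dm k : (1 < k <= n)%N ->
  cst q * (dphi k.-1 * act_dm k) = act_dm k * dphi k * T k.-1.
Proof.
case: k => [|[|k]] // k_n; rewrite act_dmE /dphi /=.
transitivity (cst (q - 1) * (cst (q ^+ k.+1) * (X 1 * P k * dD k.+2))).
  rewrite [_ * (cst (q - 1) * dD _)]cstCA -[cst (q ^+ k) * _ * _]mulrA !cstMM exprS.
  by congr (cst _ * _); ring.
rewrite -comm_dD_X1P; last by lia.
by rewrite (@big_nat_recr _ _ _ k.+1) //= -!mulrA dSK ?mulr1 ?[dD _ * (cst _ * _)]cstCA //; lia.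
Qed.

Lemma prodS_shift m k x : (k < m)%N -> (m < n)%N ->
  P m * (P k * x) = \prod_(1 <= i < k.+1) S i.+1 * (P m * x).
Proof.
move=> km mn; elim: k x km => [|k IH] x km; first by rewrite !big_nil !mul1r.
rewrite !(@big_nat_recr _ _ _ k.+1) //= -!mulrA IH ?shift_prodSS //; lia.
Qed.

(** Multiplication by S_(k+1) on the right turns Q_k P_k into Q_k P_(k+1) = P_(k+1) P_k = S_1 Q_k
    P_k, and T_1 on the left cancels S_1. *)
Lemma T1_PP k : (k.+1 < n)%N ->
  T 1 * (\prod_(1 <= i < k.+1) S i.+1 * P k) =
  \prod_(1 <= i < k.+1) S i.+1 * (P k * T k.+1).
Proof.
move=> k_n; have h1 : (0 < 1 < n)%N by lia.
have hk : (0 < k.+1 < n)%N by lia.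
rewrite -[LHS]mulr1 -[X in _ * X = _](dSK hk) mulrA.
rewrite -[_ * _ * S k.+1]mulrA -[_ * P k * _]mulrA.
have -> : P k * S k.+1 = P k.+1 by rewrite [RHS]big_nat_recr.
have := @prodS_shift k.+1 k 1; rewrite !mulr1 => <- //.
by rewrite prodS_recl -!mulrA dTVK.
Qed.

(** For i > k the factors commute with T_i one by one. For i < k both X_i and X_(i+1) occur, and T_i
    X_(i+1) X_i = q X_i S_i X_i = X_i X_(i+1) T_i. *)
Lemma comm_T_prodX i k : (0 < i < n)%N -> (k <= n)%N -> i != k ->
  GRing.comm (T i) (XX k).
Proof.
move=> h; elim: k => [|k IH] k_n ik; first by rewrite big_nil; apply: commr1.
have [ki|ki] := ltnP k i.
  by apply: commr_prod_nat => j jk; apply: dTX_comm; lia.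
rewrite big_nat_recr //=; have [eik|nik] := eqVneq i k; last first.
  by apply: commrM; [apply: IH; lia | apply: dTX_comm; lia].
subst i; case: k h ki {IH} ik k_n => // k h _ _ k_n.
rewrite big_nat_recr //= -mulrA; apply: commrM.
  by apply: commr_prod_nat => j jk; apply: dTX_comm; lia.
rewrite /GRing.comm [X k.+1 * _]dX_comm; try lia.
have TX : T k.+1 * X k.+2 = cst q * (X k.+1 * S k.+1).
  have := dXS (1 : D) h; rewrite !mulr1 => ->.
  by rewrite cstMM mulfV // rmorph1 mul1r.
rewrite mulrA TX -!mulrA; have := dSX (1 : D) h; rewrite !mulr1 => ->.
by rewrite cstCA cstMM mulfV // rmorph1 mul1r mulrA dX_comm -?mulrA //; lia.
Qed.

Lemma X1PX1 k x : (k.+1 < n)%N ->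
  X 1 * (P k.+1 * (X 1 * x)) = cst q^-1 * (X 1 * (X 2 * (T 1 * (Q k * x)))).
Proof.
move=> k_n; rewrite prodS_recl.
have C : GRing.comm (X 1) (Q k).
  apply: commr_prod_nat => i ik; apply: commS.
  by apply/esym/dTX_comm; lia.
rewrite -mulrA [Q k * _]mulrA -C -mulrA dSX //; last by lia.
by rewrite cstCA.
Qed.

Lemma T1_X1X2 x : (1 < n)%N -> T 1 * (X 1 * (X 2 * x)) = X 1 * (X 2 * (T 1 * x)).
Proof.
move=> n1; have := @comm_T_prodX 1 2 ltac:(lia) ltac:(lia) isT.
by rewrite XX2 => E; rewrite !mulrA -E !mulrA.
Qed.

Lemma dphi_dp k : (0 < k < n)%N ->
  T 1 * dphi k.+1 * act_dp k = cst q * (act_dp k * dphi k).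
Proof.
case: k => // k k_n; rewrite act_dpE /dphi /=.
have -> : T 1 * (cst (q ^+ k.+1) * (X 1 * P k.+1)) * (cst (q ^+ k.+1) * (X 1 * P k.+1)) =
   cst (q ^+ k.+1 * q ^+ k.+1) * (T 1 * (X 1 * (P k.+1 * (X 1 * P k.+1)))).
  by rewrite [T 1 * _]cstCA cstCA -[cst _ * _ * _]mulrA cstMM -!mulrA.
have -> : cst q * (cst (q ^+ k.+1) * (X 1 * P k.+1) * (cst (q ^+ k) * (X 1 * P k))) =
   cst (q ^+ k.+1 * q ^+ k.+1) * (X 1 * (P k.+1 * (X 1 * P k))).
  rewrite [_ * (cst (q ^+ k) * _)]cstCA -[cst (q ^+ k.+1) * _ * _]mulrA !cstMM -!mulrA.
  by congr (cst _ * _); rewrite exprS; ring.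
rewrite !X1PX1; try lia.
congr (_ * _); rewrite cstCA; congr (_ * _); rewrite T1_X1X2; last by lia.
do 3 congr (_ * _).
(* What is left is T_1 Q_k P_(k+1) = Q_k P_k, that is, [T1_PP] multiplied by S_(k+1). *)
rewrite [\prod_(1 <= i < k.+2) S i]big_nat_recr //= [Q k * _]mulrA [T 1 * _]mulrA.
by rewrite T1_PP -?mulrA ?dTK ?mulr1 //; lia.
Qed.

Lemma act_dp2 k : (k.+1 < n)%N ->
  act_dp k.+1 * act_dp k =
  cst (q ^+ k.+1 * q ^+ k / q) * (X 1 * (X 2 * (T 1 * (Q k * P k)))).
Proof.
move=> k_n; rewrite !act_dpE [_ * (cst (q ^+ k) * _)]cstCA -[cst (q ^+ k.+1) * _ * _]mulrA.
rewrite -[X 1 * _ * _]mulrA X1PX1 // !cstMM.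
by congr (cst _ * _); ring.
Qed.

Lemma act_dpT k i : (0 < i < k)%N -> (k < n)%N ->
  act_dp k * T i = T i.+1 * act_dp k.
Proof.
move=> ik k_n; rewrite act_dpE cstCA -mulrA; congr (_ * _).
have := shift_prodS (1 : D) ik k_n; rewrite !mulr1 -mulrA => ->.
rewrite mulrA -dTX_comm -?mulrA //; lia.
Qed.

(** The case i = 1 is the relation Y_1 T_1 X_1 = X_2 Y_1 T_1; the others follow from q Y_(i+1) = T_i
    Y_i T_i, because d_+ shifts the T_i too. *)
Lemma act_dpY k i : (0 < i <= k)%N -> (k < n)%N ->
  act_dp k * Y i = Y i.+1 * act_dp k.
Proof.
move=> ik k_n; have := fun j jk => @act_dpT k j jk k_n.
have : act_dp k * Y 1 = Y 2 * act_dp k.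
  rewrite act_dpE cstCA -mulrA; congr (_ * _).
  case: k ik k_n => [|k] ik k_n; first by lia.
  rewrite prodS_recl.
  have C : GRing.comm (Y 1) (Q k).
    apply: commr_prod_nat => j jk; apply: commS.
    by apply/esym/dTY_comm; lia.
  have h1 : (0 < 1 < n)%N by lia.
  rewrite -!mulrA -C; apply: (cst_inj q0); rewrite [RHS]mulrA -[cst q * Y 2]dTYT // -!mulrA.
  have E x : Y 1 * (T 1 * (X 1 * x)) = X 2 * (Y 1 * (T 1 * x)).
    by rewrite !mulrA dYTX //; lia.
  by rewrite E dTVK // [RHS]mulrA (dXS _ h1) cstMM mulfV // rmorph1 mul1r mulrA.
move: (act_dp k) => d dY1 dT_; elim: i ik => // i IH ik.
have [->|i0] := posnP i; first exact: dY1.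
have h : (0 < i < n)%N by lia.
have h' : (0 < i.+1 < n)%N by lia.
apply: (cst_inj q0).
rewrite -(TYT _ h') -cstCA -[cst q * Y _]dTYT // !mulrA dT_; last by lia.
rewrite -!mulrA -dT_; last by lia.
by rewrite !mulrA -[T _ * _ * _]mulrA IH ?mulrA //; lia.
Qed.

Lemma dXSXS i x : (0 < i < n)%N -> S i * (X i * (S i * x)) = cst q^-1 * (X i.+1 * x).
Proof. by move=> h; rewrite dSX // dTVK. Qed.

(** * Commutation of omega with the X_i, and the products Y_i X_1 ... X_k *)

Lemma omega_S i : (0 < i)%N -> (i.+1 < n)%N -> domega * S i = S i.+1 * domega.
Proof.
move=> i0 i_n; rewrite -[LHS](@dSVK i.+1); last by lia.
by rewrite [T i.+1 * _]mulrA -omega_T // -[domega * _ * _]mulrA dTK ?mulr1 //; lia.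
Qed.

(** The case i = 1 comes from Y_1 T_1 X_1 = X_2 Y_1 T_1. The induction uses q^-1 X_(i+1) = S_i X_i
    S_i and the fact that omega shifts S_i to S_(i+1). *)
Lemma omega_X i : (0 < i < n)%N -> domega * X i = X i.+1 * domega.
Proof.
elim: i => // i IH i_n; have [->|i0] := posnP i.
  rewrite domegaE big_ltn; last by lia.
  have C : GRing.comm (X 1) (\prod_(2 <= i < n) T i).
    by apply: commr_prod_nat => j jn; apply/esym/dTX_comm; lia.
  by rewrite -!mulrA -C !mulrA dYTX //; lia.
have h : (0 < i < n)%N by lia.
have qV : q^-1 != 0 by rewrite invr_eq0.
apply: (cst_inj qV); rewrite -cstCA.
have := dXSXS 1 h; rewrite !mulr1 => <-.
have h' : (0 < i.+1 < n)%N by lia.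
rewrite mulrA omega_S; try lia.
rewrite -[_ * domega * _]mulrA [domega * _]mulrA IH // -mulrA omega_S; try lia.
by rewrite dXSXS.
Qed.

Lemma omega_prodX k : (k < n)%N ->
  domega * XX k = \prod_(1 <= i < k.+1) X i.+1 * domega.
Proof.
elim: k => [|k IH] k_n; first by rewrite !big_nil mulr1 mul1r.
rewrite !(@big_nat_recr _ _ _ k.+1) //= mulrA IH ?(ltnW k_n) // -!mulrA.
by rewrite omega_X.
Qed.

(** After multiplication by X_2 ... X_n on the left, the left side is omega X_1 ... X_n. The T_i
    commute with X_1 ... X_n, so the relation between Y_1 and this product applies. *)
Lemma omega_Xn : (0 < n)%N -> domega * X n = cst t * (X 1 * domega).
Proof.
move=> n0; apply: (@dXshift_lreg n.-1); first by lia.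
rewrite cstCA mulrA -omega_prodX; last by lia.
rewrite [_ * (X 1 * _)]mulrA prednK // prodX_rot ?n0 ?leqnn //.
have := dYX n0; rewrite -mulrA.
have -> : \prod_(1 <= i < n) X i * X n = XX n by rewrite big_nat_recr.
have C : GRing.comm (\prod_(1 <= i < n) T i) (XX n).
  apply/esym; apply: commr_prod_nat => i ik.
  by apply/esym; apply: comm_T_prodX; lia.
by move=> E; rewrite domegaE -[LHS]mulrA C [LHS]mulrA E -!mulrA.
Qed.

Lemma X1_prodS k : (k < n)%N ->
  X 1 * P k = cst (q ^+ k)^-1 * (\prod_(1 <= i < k.+1) T i * X k.+1).
Proof.
elim: k => [|k IH] k_n.
  by rewrite !big_nil expr0 invr1 rmorph1 mulr1 !mul1r.
rewrite !(@big_nat_recr _ _ _ k.+1) //= mulrA IH; last by lia.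
have := @dXS k.+1 1 ltac:(lia); rewrite !mulr1 -!mulrA => ->.
by rewrite cstCA cstMM exprS invfM mulrC.
Qed.

Lemma prodT_cancel k j : (0 < k)%N -> (k + j <= n)%N ->
  \prod_(1 <= i < k + j) T i * \prod_(i <- rev (iota k j)) S i =
  \prod_(1 <= i < k) T i.
Proof.
move=> k0; elim: j => [|j IH] kj; first by rewrite big_nil mulr1 addn0.
rewrite rev_iotaS big_cons addnS big_nat_recr /=; last by lia.
by rewrite -mulrA dTVK ?IH //; lia.
Qed.

Lemma prodS_Y k : (k < n)%N ->
  P k * Y k.+1 = cst (q ^+ k)^-1 * (Y 1 * \prod_(1 <= i < k.+1) T i).
Proof.
elim: k => [|k IH] k_n.
  by rewrite !big_nil expr0 invr1 rmorph1 mulr1 !mul1r.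
rewrite !(@big_nat_recr _ _ _ k.+1) //= -mulrA.
have -> : S k.+1 * Y k.+2 = cst q^-1 * (Y k.+1 * T k.+1).
  apply: (cst_inj q0); rewrite cstMM mulfV // rmorph1 mul1r -cstCA.
  by rewrite -dTYT -?mulrA ?dSVK //; lia.
rewrite cstCA [P k * _]mulrA IH; last by lia.
by rewrite -!mulrA cstMM exprS invfM.
Qed.

Lemma prodS_rev_X k j : (0 < k)%N -> (k + j <= n)%N ->
  \prod_(i <- rev (iota k j)) S i * X k =
  cst (q ^+ j)^-1 * (X (k + j) * \prod_(i <- rev (iota k j)) T i).
Proof.
move=> k0; elim: j => [|j IH] kj.
  by rewrite !big_nil expr0 invr1 rmorph1 mulr1 !mul1r addn0.
rewrite !rev_iotaS !big_cons -mulrA IH; last by lia.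
rewrite cstCA dSX; try lia.
by rewrite cstMM exprS invfM addnS mulrC.
Qed.

(** Write Y_1 = omega (S_(n-1) ... S_k) R. Here R commutes with X_1 ... X_k, while S_(n-1) ... S_k
    commutes with X_1 ... X_(k-1) and carries X_k to X_n, up to a scalar and T factors on the right.
    Finally omega turns X_1 ... X_(k-1) X_n into t X_2 ... X_k X_1. *)
Lemma Y1_prodX k : (0 < k <= n)%N -> exists U, Y 1 * XX k = XX k * U.
Proof.
move=> k_n; set R := \prod_(i <- rev (iota 1 k.-1)) S i.
pose U := \prod_(i <- rev (iota k (n - k))) T i * R.
exists (cst ((q ^+ (n - k))^-1 * t) * (domega * U)).
have -> : Y 1 = domega * (\prod_(i <- rev (iota k (n - k))) S i * R).
  have E : iota 1 n.-1 = iota 1 k.-1 ++ iota k (n - k).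
    have -> : n.-1 = (k.-1 + (n - k))%N by lia.
    by rewrite iotaD; congr (_ ++ iota _ _); lia.
  rewrite -big_cat -rev_cat -E domegaE -mulrA.
  have := @prodT_cancel 1 n.-1 isT; rewrite add1n prednK; last by lia.
  by move=> ->; rewrite ?big_geq ?mulr1.
have -> : XX k = \prod_(1 <= i < k) X i * X k.
  by rewrite big_nat_recr //=; lia.
have C1 : GRing.comm R (\prod_(1 <= i < k) X i * X k).
  have -> : \prod_(1 <= i < k) X i * X k = XX k by rewrite big_nat_recr //=; lia.
  rewrite /R; apply/esym/commr_prod_seq => i; rewrite mem_rev mem_iota => ik.
  by apply/commS/esym; apply: comm_T_prodX; lia.
have C2 : GRing.comm (\prod_(i <- rev (iota k (n - k))) S i) (\prod_(1 <= i < k) X i).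
  apply/esym/commr_prod_seq => i; rewrite mem_rev mem_iota => ik.
  have -> : \prod_(1 <= j < k) X j = XX k.-1 by rewrite prednK //; lia.
  by apply/commS/esym; apply: comm_T_prodX; lia.
rewrite -!mulrA C1 -!mulrA [\prod_(i <- _) S i * _]mulrA C2 -!mulrA.
rewrite [\prod_(i <- _) S i * _]mulrA prodS_rev_X; try lia.
rewrite subnKC; last by lia.
have E : domega * \prod_(1 <= i < k) X i = \prod_(1 <= i < k) X i.+1 * domega.
  have := @omega_prodX k.-1; rewrite prednK; last by lia.
  by apply; lia.
rewrite [domega * _]mulrA E -!mulrA !cstCA [domega * (X n * _)]mulrA omega_Xn; last by lia.
rewrite -!mulrA cstCA cstMM; congr (_ * _).
rewrite [_ * (X 1 * _)]mulrA prodX_rot // [RHS]mulrA; congr (_ * _).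
by rewrite big_nat_recr //=; lia.
Qed.

Lemma Yi_prodX i k : (0 < i <= k)%N -> (k <= n)%N -> exists U, Y i * XX k = XX k * U.
Proof.
elim: i => // i IH ik k_n; have [->|i0] := posnP i; first by apply: Y1_prodX; lia.
have [U YU] := IH ltac:(lia) k_n.
exists (cst q^-1 * (T i * (U * T i))); apply: (cst_inj q0).
rewrite cstCA cstMM mulfV // rmorph1 mul1r mulrA -dTYT; last by lia.
have TX : T i * XX k = XX k * T i by apply: comm_T_prodX; lia.
by rewrite -!mulrA TX (mulrA (Y i)) YU -(mulrA (XX k)) [LHS]mulrA TX -!mulrA.
Qed.

(** The second factor commutes with the [T_j], because [X_1 ... X_k] can be cancelled. *)
Lemma Y_prodX i k : (0 < i <= k)%N -> (k <= n)%N -> exists2 U, Y i * XX k = XX k * U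
  & forall j, (k < j < n)%N -> GRing.comm (T j) U.
Proof.
move=> ik k_n; have [U YU] := Yi_prodX ik k_n; exists U => // j kj.
have TX : T j * XX k = XX k * T j by apply: comm_T_prodX; lia.
apply: (dXX_lreg k_n); rewrite mulrA -TX -mulrA -YU [LHS]mulrA dTY_comm; try lia.
by rewrite -mulrA TX mulrA YU -mulrA.
Qed.

(** By [X1_prodS], X_1 S_1 ... S_(n-1) is a multiple of T_1 ... T_(n-1) X_n, so that Y_1 in front
    completes omega X_n. *)
Lemma Y1_X1 : (0 < n)%N ->
  Y 1 * (X 1 * P n.-1) = cst ((q ^+ n.-1)^-1 * t) * (X 1 * domega).
Proof.
move=> n0; rewrite X1_prodS; last by lia.
rewrite prednK // cstCA [Y 1 * _]mulrA -domegaE omega_Xn //.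
by rewrite cstMM.
Qed.

Lemma act_dm2_T k : (1 < k <= n)%N ->
  act_dm k.-1 * act_dm k * T k.-1 = act_dm k.-1 * act_dm k.
Proof.
case: k => [|[|k]] //= k_n; rewrite !act_dmE.
have := @dDD_annihilates k.+1 ltac:(lia).
rewrite !mulrBr !mulr1 => /eqP; rewrite subr_eq0 => /eqP E.
have F x : cst (q - 1) * dD k.+1 * (cst (q - 1) * dD k.+2) * x =
   cst ((q - 1) * (q - 1)) * (dD k.+1 * (dD k.+2 * x)).
  by rewrite cstCA -!mulrA cstMM.
by rewrite -[RHS]mulr1 !F E mulr1.
Qed.

(** * Identities on vectors fixed by T_(k+1), ..., T_(n-1) *)

Section Module.
Variable V : lmodType D.

(** Every vector of L_k has this property, by [Lk_inv]; relations that are not derived in the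
    algebra itself are checked on such vectors. *)
Definition hecke_inv k (v : V) := forall i, (k < i < n)%N -> T i *: v = v.

Lemma hecke_invS k v i : hecke_inv k v -> (k < i < n)%N -> S i *: v = v.
Proof. by move=> vk ki; rewrite -{1}[v](vk i) // scalerA dSK ?scale1r //; lia. Qed.

Lemma dD_telescope k v : (0 < k <= n)%N -> hecke_inv k v ->
  (cst (q - 1) * dD k + 1) *: v =
  (cst (q ^+ (n - k).+1) * (\prod_(k <= i < n) S i *
     \prod_(i <- rev (iota k (n - k))) S i)) *: v.
Proof.
move=> /andP[k0 k_n]; have [m mE] : exists m, m = (n - k)%N by exists (n - k)%N.
elim: m k k0 k_n mE v => [|m IH] k k0 k_n mE v vk.
  have -> : k = n by lia.
  rewrite subnn dD_n // big_geq // big_nil expr1 !mulr1 rmorphB rmorph1.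
  by rewrite subrK.
have k_n' : (k < n)%N by lia.
(* The induction hypothesis is applied to S_k v, and q S_k is then applied to the result. *)
have bk : hecke_inv k.+1 (S k *: v).
  move=> i ki; rewrite scalerA -dST ?[X in _ || X]orbC; try lia.
  by rewrite -scalerA vk //; lia.
rewrite -mE (_ : iota k m.+1 = k :: iota k.+1 m) // rev_cons big_rcons /=.
rewrite big_ltn; last by lia.
set QR := \prod_(k.+1 <= i < n) S i * \prod_(i <- rev (iota k.+1 m)) S i.
have -> : cst (q ^+ m.+2) * (S k * \prod_(k.+1 <= i < n) S i *
    (\prod_(i <- rev (iota k.+1 m)) S i * S k)) =
    cst q * (S k * (cst (q ^+ m.+1) * QR * S k)).
  by rewrite /QR exprS rmorphM -!mulrA [S k * (cst _ * _)]cstCA.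
have mE' : m = (n - k.+1)%N by lia.
have := IH k.+1 isT k_n' mE' _ bk; rewrite -mE' -/QR => {}IH.
rewrite -(scalerA (cst q)) -(scalerA (S k)) -(scalerA (cst _ * QR)) -IH {IH QR mE'}.
(* S_k crosses D_(k+1) - 1 = q D_(k+2) S_(k+1) by the braid relation, and is absorbed because
   S_(k+1) v = v. *)
have SDS : S k *: (dD k.+1 *: (S k *: v)) =
    S k *: (S k *: v) + (dD k.+1 *: (S k *: v) - S k *: v).
  have [k1n|k1n] := eqVneq k.+1 n.
    by rewrite k1n dD_n // scale1r subrr addr0.
  rewrite (@dD_rec k.+1); last by lia.
  rewrite !scalerDl !scale1r scalerDr; congr (_ + _).
  rewrite [RHS]addrAC subrr add0r !scalerA.
  have C : GRing.comm (S k) (dD k.+2).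
    by apply: dD_comm => // [|i ki]; [lia | apply: dST; lia].
  rewrite cstCA -!mulrA [S k * (dD _ * _)]mulrA C.
  have := @dSSS k 1; rewrite !mulr1 => E; try lia.
  rewrite -!mulrA E; try lia.
  by rewrite -!scalerA (@hecke_invS k v k.+1) //; lia.
have Sq : cst (q * q) *: (S k *: (S k *: v)) =
    cst (q * (q - 1)) *: (S k *: v) + cst q *: v.
  rewrite rmorphM -scalerA [cst q *: (S k *: _)]scalerA dTinvE // scalerDl.
  by rewrite [T k *: _]scalerA dTK // ?scale1r ?scalerDr ?scalerA -?rmorphM 1?addrC //; lia.
rewrite dD_rec // !scalerDl !scale1r mulrDr mulr1 scalerDl.
rewrite -!scalerA scalerDr [S k *: (cst _ *: _)]scalerA cstC -scalerA SDS.
(* Only a linear identity between v, b = S_k v, a = S_k S_k v and d = D_(k+1) S_k v remains, with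
   [Sq] relating a to b and v. *)
move: Sq {SDS bk}; move: (dD k.+1 *: _) => d; move: (S k *: (S k *: v)) => a.
move: (S k *: v) => b Sq.
rewrite -[X in _ + X]scale1r addrAC -scalerDl -(rmorph1 (dcst q t n)) -rmorphD subrK.
rewrite addrA [a + _ - _]addrAC !scalerDr !scalerN !scalerA -!rmorphM.
rewrite [q * (q - 1)]mulrC addrAC; congr (_ + _).
have -> : cst q *: v = cst (q * q) *: a - cst ((q - 1) * q) *: b.
  by rewrite Sq [q * _]mulrC addrAC subrr add0r.
rewrite addrAC; congr (_ - _).
by rewrite -scalerDl -rmorphD; congr (cst _ *: _); ring.
Qed.

(** d_+^2 is a multiple of X_1 X_2 T_1 Q_k P_k; T_1 commutes with X_1 X_2 and leaves Q_k P_k on the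
    right as T_(k+1), which fixes v. *)
Lemma T_act_dp2 k (v : V) : (k.+1 < n)%N -> hecke_inv k v ->
  (T 1 * act_dp k.+1 * act_dp k) *: v = (act_dp k.+1 * act_dp k) *: v.
Proof.
move=> k_n vk; rewrite -mulrA act_dp2 // cstCA -!(scalerA (cst _)); congr (_ *: _).
rewrite T1_X1X2 //; last by lia.
have := @T1_PP k k_n; rewrite [X in _ = X -> _]mulrA.
move: (_ * \prod_(1 <= i < k.+1) S i) => W TW.
by rewrite {1}TW !mulrA -scalerA vk //; lia.
Qed.

(** This is the core of the last relation. By [dD_telescope], phi is completed to X_1 S_1 ...
    S_(n-1), from which Y_1 produces X_1 omega; the remaining S_(n-1) ... S_k shortens omega to Y_1
    T_1 ... T_(k-1), a multiple of S_1 ... S_(k-1) Y_k. *)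
Lemma Y1_dphi_dD k (v : V) : (0 < k <= n)%N -> hecke_inv k v ->
  (Y 1 * (dphi k * (cst (q - 1) * dD k + 1))) *: v = (cst (q * t) * (dphi k * Y k)) *: v.
Proof.
case: k => // k k_n vk; rewrite -!(scalerA (Y 1)) -(scalerA (dphi _)) dD_telescope //.
rewrite !scalerA; congr (_ *: _); rewrite /dphi /=.
rewrite -(mulrA (Y 1)).
set c := q ^+ _.+1; set A := \prod_(k.+1 <= i < n) S i; set R := \prod_(i <- rev _) S i.
have -> : Y 1 * (cst (q ^+ k) * (X 1 * \prod_(1 <= i < k.+1) S i) * (cst c * (A * R))) =
    cst (q ^+ k * c) * (Y 1 * (X 1 * (\prod_(1 <= i < k.+1) S i * A)) * R).
  rewrite -[cst (q ^+ k) * _ * _]mulrA [_ * (cst c * _)]cstCA cstMM cstCA.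
  by rewrite -!mulrA.
have -> : cst (q * t) * (cst (q ^+ k) * (X 1 * \prod_(1 <= i < k.+1) S i) * Y k.+1) =
    cst (q * t * q ^+ k) * (X 1 * (\prod_(1 <= i < k.+1) S i * Y k.+1)).
  by rewrite -[cst (q ^+ k) * _ * _]mulrA cstMM -!mulrA.
rewrite (@prodS_full k.+1) // Y1_X1 //; last by lia.
rewrite prodS_Y // [X 1 * (cst _ * _)]cstCA -!mulrA !cstMM.
have -> : domega * R = Y 1 * \prod_(1 <= i < k.+1) T i.
  rewrite domegaE -mulrA; congr (_ * _).
  have := @prodT_cancel k.+1 (n - k.+1) isT.
  by rewrite subnKC //; apply.
congr (cst _ * _).
have -> : n.-1 = (n - k.+1 + k)%N by lia.
rewrite /c exprS exprD; have := expf_neq0 k q0; have := expf_neq0 (n - k.+1) q0.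
move: (q ^+ k) (q ^+ (n - k.+1)) => a b a0 b0.
by field; rewrite a0 b0.
Qed.

End Module.

Hypothesis q1 : q != 1.

Lemma dphiE k : (0 < k < n)%N ->
  cst (q - 1)^-1 * (act_dp k.-1 * act_dm k - act_dm k.+1 * act_dp k) = dphi k.
Proof.
move=> k_n; rewrite dp_dm ?dm_dp //; last by lia.
rewrite -mulrBr cstVK ?subr_eq0 // -[cst q * (dphi k * _)]cstCA -mulrBr.
by rewrite dD_sub ?mulr1 //; lia.
Qed.

(** At the last vertex d_- d_+ vanishes because L_(n+1) = 0, so d_+ d_- is the whole commutator, and
    D_n = 1. *)
Lemma dphi_n : (0 < n)%N -> cst (q - 1)^-1 * (act_dp n.-1 * act_dm n) = dphi n.
Proof.
by move=> n0; rewrite dp_dm ?n0 ?leqnn // cstVK ?subr_eq0 // dD_n mulr1.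
Qed.

(** The bracket on the left is (q - 1) d_+ d_- + [d_+, d_-] = (q - 1) phi ((q - 1) D_k + 1), so that
    [Y1_dphi_dD] applies. *)
Lemma z_act_zdd k (V : lmodType D) (v : V) : (0 < k < n)%N -> hecke_inv k v ->
  (cst (q * t)^-1 * Y 1 *
     (cst q * (act_dp k.-1 * act_dm k) - act_dm k.+1 * act_dp k)) *: v =
  (cst (q * t) * ((act_dp k.-1 * act_dm k - act_dm k.+1 * act_dp k) *
     (cst (q * t)^-1 * Y k))) *: v.
Proof.
move=> k_n vk.
have E : act_dp k.-1 * act_dm k - act_dm k.+1 * act_dp k = cst (q - 1) * dphi k.
  rewrite -(dphiE k_n) cstMM mulfV ?subr_eq0 // rmorph1 mul1r //.
have -> : cst q * (act_dp k.-1 * act_dm k) - act_dm k.+1 * act_dp k =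
    cst (q - 1) * (dphi k * (cst (q - 1) * dD k + 1)).
  rewrite -[X in X - _](subrK (act_dp k.-1 * act_dm k)) -addrA E.
  have -> : cst q * (act_dp k.-1 * act_dm k) - act_dp k.-1 * act_dm k =
      cst (q - 1) * (act_dp k.-1 * act_dm k).
    by rewrite rmorphB rmorph1 mulrBl mul1r.
  rewrite dp_dm //; last by lia.
  by rewrite [dphi k * (_ + 1)]mulrDr mulr1 mulrDr [dphi k * (cst _ * _)]cstCA.
rewrite E; set Z := dphi k * _; set c := q * t.
have -> : cst c^-1 * Y 1 * (cst (q - 1) * Z) = cst (c^-1 * (q - 1)) * (Y 1 * Z).
  by rewrite cstCA -mulrA cstMM mulrC.
have -> : cst c * (cst (q - 1) * dphi k * (cst c^-1 * Y k)) =
    cst (c^-1 * (q - 1)) * (cst c * (dphi k * Y k)).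
  rewrite -[cst (q - 1) * _ * _]mulrA [dphi k * _]cstCA !cstMM.
  by congr (cst _ * _); ring.
rewrite -!(scalerA (cst (c^-1 * _))); congr (_ *: _).
by rewrite Y1_dphi_dD //; lia.
Qed.

Lemma z_act_zdd_n (V : lmodType D) (v : V) : (0 < n)%N -> hecke_inv n v ->
  (cst (q * t)^-1 * Y 1 * (cst q * (act_dp n.-1 * act_dm n))) *: v =
  (cst (q * t) * (act_dp n.-1 * act_dm n * (cst (q * t)^-1 * Y n))) *: v.
Proof.
move=> n0 vk; rewrite dp_dm ?n0 ?leqnn // dD_n mulr1.
have E : (Y 1 * (dphi n * cst q)) *: v = (cst (q * t) * (dphi n * Y n)) *: v.
  have := @Y1_dphi_dD V n v; rewrite n0 leqnn dD_n mulr1 => /(_ isT vk) <-.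
  by rewrite rmorphB rmorph1 subrK.
set c := q * t.
have -> : cst c^-1 * Y 1 * (cst q * (cst (q - 1) * dphi n)) =
   cst (c^-1 * (q - 1)) * (Y 1 * (dphi n * cst q)).
  rewrite cstMM [LHS]cstCA -[cst c^-1 * _ * _]mulrA cstC [Y 1 * (cst q * _)]cstCA.
  by rewrite !cstMM; congr (cst _ * _); ring.
have -> : cst c * (cst (q - 1) * dphi n * (cst c^-1 * Y n)) =
    cst (c^-1 * (q - 1)) * (cst c * (dphi n * Y n)).
  rewrite -[cst (q - 1) * _ * _]mulrA [dphi n * _]cstCA !cstMM.
  by congr (cst _ * _); ring.
by rewrite -!(scalerA (cst (c^-1 * _))) E.
Qed.

End PositiveDAHA.

(** * The symmetrizers and the spaces L_k *)

Lemma ascent_stransp n i (s : 'S_n) : (0 < i < n)%N ->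
  `[< ascent i (stransp n i * s)%g >] = ~~ `[< ascent i s >].
Proof.
move=> h; case: asboolP => asc; case: asboolP => asc' //.
  by have := ninv_ascent h asc; have := ninv_ascent h asc'; rewrite stranspK; lia.
by have := ninv_descent h asc; have := ninv_descent h asc'; rewrite stranspK; lia.
Qed.

(** Nonzero constants are among the polynomials tested, so this includes characteristic zero;
    integer coefficients express transcendence over the rationals. *)
Definition transcendental (K : fieldType) (q : K) :=
  forall p : {poly int}, p != 0 -> (map_poly intr p).[q] != 0.

(** * Scalars that do not vanish because q is transcendental *)

Section Transcendental.
Variables (K : fieldType) (q : K).
Hypothesis qtr : transcendental q.

Lemma transcendental_neq0 : q != 0.
Proof. by have := qtr (monic_neq0 (monicX _)); rewrite map_polyX hornerX. Qed.

Lemma transcendental_expr_neq1 i : (0 < i)%N -> 1 - q ^+ i != 0.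
Proof.
move=> i0; have p0 : 1 - 'X^i != 0 :> {poly int}.
  by rewrite -opprB oppr_eq0 -size_poly_eq0 size_XnsubC.
have := qtr p0; rewrite rmorphB rmorph1 rmorphXn /= map_polyX.
by rewrite !hornerE.
Qed.

Lemma transcendental_neq1 : q != 1.
Proof. by have := transcendental_expr_neq1 (isT : 0 < 1)%N; rewrite expr1 subr_eq0 eq_sym. Qed.

Lemma qfact_neq0 m : qfact q m != 0.
Proof.
rewrite /qfact prodf_seq_neq0; apply/allP => i; rewrite mem_index_iota => /andP[i0 _].
rewrite mulf_neq0 ?invr_eq0 ?transcendental_expr_neq1 //.
by have := transcendental_expr_neq1 (isT : 0 < 1)%N; rewrite expr1.
Qed.

(** A power of q turns the sum into the value at q of an integer polynomial, which is nonzero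
    because its value at 1 is the cardinal of A. *)
Lemma sum_expr_neq0 (I : finType) (A : {set I}) (l : I -> nat) (c : nat) :
  (0 < #|A|)%N -> \sum_(s in A) q ^ (c%:Z - (l s)%:Z) != 0.
Proof.
have q0 := transcendental_neq0.
move=> A0; pose M := (\sum_(s in A) l s)%N.
have lM s : s \in A -> (l s <= M)%N by move=> sA; rewrite /M (bigD1 s) //= leq_addr.
pose p : {poly int} := \sum_(s in A) 'X^(M - l s).
have p0 : p != 0.
  apply/eqP => /(congr1 (fun r => r.[1])); rewrite horner0 horner_sum.
  rewrite (eq_bigr (fun _ => 1)); last by move=> s _; rewrite hornerXn expr1n.
  by rewrite sumr_const => /eqP; rewrite pnatr_eq0 -leqn0 leqNgt A0.
have := qtr p0; rewrite /p rmorph_sum horner_sum /= => pq.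
apply: contra_neq pq => /(congr1 (fun x => q ^ (M%:Z - c%:Z) * x)).
rewrite mulr0 mulr_sumr => E; rewrite -[RHS]E; apply: eq_bigr => s sA.
rewrite rmorphXn /= map_polyX hornerXn -expfzDr // addrA subrK.
by rewrite subzn ?lM.
Qed.
End Transcendental.

Section Symmetrizer.
Variables (K : fieldType) (q t : K) (n : nat).
Local Notation D := (Dplus q t n).
Local Notation T := (dT q t n).
Local Notation X := (dX q t n).
Local Notation Y := (dY q t n).
Local Notation cst := (dcst q t n).
Local Notation S := (dS q t n).
Local Notation XX k := (\prod_(1 <= i < k.+1) X i).
Hypothesis qtr : transcendental q.
Let q0 := transcendental_neq0 qtr.

Lemma Tperm_ascent i (s : 'S_n) : (0 < i < n)%N -> ascent i s ->
  Tperm q t (stransp n i * s)%g = T i * Tperm q t s.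
Proof.
move=> h asc; apply: Tw_redword_ascent => // [j j0 jn|j l hj hl jl].
  exact: dT_braid.
by apply: dT_comm => //; rewrite jl.
Qed.

Lemma dT_symm i x : (0 < i < n)%N ->
  T i * (x + cst q^-1 * (T i * x)) = x + cst q^-1 * (T i * x).
Proof.
move=> h; rewrite mulrDr cstCA [T i * (T i * _)]mulrA dTT // mulrBl mulrBr.
rewrite cstMM mulVf // rmorph1 mul1r -mulrA cstMM mulrBr mulVf // mulr1.
by rewrite rmorphB rmorph1 mulrBl mul1r opprB addrCA [T i * x + _]addrC subrK.
Qed.

(** The Young subgroup splits into pairs s, s_i s with i an ascent of s. The two terms of a pair add
    up to x + q^-1 T_i x, which T_i fixes by [dT_symm]. *)
Lemma dT_deps i k : (k < i < n)%N -> T i * deps q t n k = deps q t n k.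
Proof.
move=> ki; have h : (0 < i < n)%N by lia.
rewrite /deps cstCA; congr (_ * _).
pose F (s : 'S_n) := cst (q ^ ('C(n - k, 2)%:Z - (plength s)%:Z)) * Tperm q t s.
rewrite -[\sum_(s in _) _]/(\sum_(s in young n k) F s).
rewrite (bigID (fun s => `[< ascent i s >])) /=.
rewrite [X in _ + X](reindex_inj (mulgI (stransp n i))) /=.
rewrite [X in _ + X](eq_bigl (fun s => (s \in young n k) && `[< ascent i s >])); last first.
  by move=> s; rewrite young_stransp // ascent_stransp // negbK.
rewrite -big_split /= mulr_sumr; apply: eq_bigr => s /andP[_ /asboolP asc].
have -> : F (stransp n i * s)%g = cst q^-1 * (T i * F s).
  rewrite /F !plengthE ninv_ascent // Tperm_ascent // cstCA cstMM; congr (cst _ * _).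
  rewrite -[q^-1]/(q ^ (-1)) -expfzDr //; congr (q ^ _); lia.
exact: dT_symm.
Qed.

Lemma prodS_prodX k : (k < n)%N ->
  \prod_(1 <= i < k.+1) S i * XX k =
  cst (q ^+ k)^-1 * (\prod_(1 <= i < k.+1) X i.+1 * \prod_(1 <= i < k.+1) T i).
Proof.
elim: k => [|k IH] k_n; first by rewrite !big_nil expr0 invr1 rmorph1 !mul1r.
rewrite !(@big_nat_recr _ _ _ k.+1) //= -mulrA [S _ * _]mulrA.
have -> : S k.+1 * XX k = XX k * S k.+1.
  by apply/esym/commS/esym; apply: comm_T_prodX; lia.
rewrite -[XX k * _ * _]mulrA; have := @dSX _ q t n q0 k.+1 1 ltac:(lia).
rewrite !mulr1 => ->; rewrite cstCA cstCA [_ * (XX k * _)]mulrA IH; last by lia.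
rewrite -!mulrA cstMM exprS invfM; congr (_ * (_ * _)).
rewrite [LHS]mulrA [RHS]mulrA; congr (_ * _); apply/esym; apply: commr_prod_nat => i ik.
by apply/esym/dTX_comm; lia.
Qed.

(** * Description of L_k and its stability under the operators *)

Section Module.
Variable V : lmodType D.
Local Notation inv := (@hecke_inv K q t n V).

Lemma Tperm_inv k (s : 'S_n) v : s \in young n k -> inv k v -> Tperm q t s *: v = v.
Proof.
move=> sk vk; rewrite /Tperm.
have [j j0 jn|j l hj hl jl|w -> kw] := @young_redword n _ T _ _ k s sk.
- exact: dT_braid.
- by apply: dT_comm => //; rewrite jl.
elim: w kw => [|i w IH] /=; first by rewrite big_nil scale1r.
by case/andP=> ki kw; rewrite big_cons -scalerA IH // vk.
Qed.

Lemma deps_inv k : exists2 c : K, c != 0 &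
  forall v, inv k v -> deps q t n k *: v = cst c *: v.
Proof.
(* Each T_sigma of the Young subgroup fixes v, so eps_k acts by the sum of its coefficients. *)
exists ((qfact q (n - k))^-1 *
   \sum_(s in young n k) q ^ ('C(n - k, 2)%:Z - (plength s)%:Z)).
  rewrite mulf_neq0 ?invr_eq0 ?qfact_neq0 // sum_expr_neq0 //.
  by apply/card_gt0P; exists 1%g; rewrite inE; apply/forallP => i; rewrite perm1 eqxx implybT.
move=> v vk; rewrite /deps rmorphM -!scalerA; congr (_ *: _).
rewrite rmorph_sum !scaler_suml; apply: eq_bigr => s sk.
by rewrite -scalerA (Tperm_inv sk).
Qed.

Lemma LkP k v : Lk k v <-> exists2 w : V, inv k w & v = XX k *: w.
Proof.
split=> [[w _ <-]|[w wk ->]].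
  exists (deps q t n k *: w); last by rewrite scalerA.
  by move=> i ki; rewrite scalerA dT_deps.
have [c c0 cE] := deps_inv k; exists (cst c^-1 *: w) => //.
have wk' : inv k (cst c^-1 *: w).
  by move=> i ki; rewrite scalerA cstC -scalerA wk.
by rewrite /Lproj -scalerA cE // [cst c *: _]scalerA -rmorphM mulfV // rmorph1 scale1r.
Qed.

Lemma Lk_inv k v : (k <= n)%N -> Lk k v -> inv k v.
Proof.
move=> k_n /LkP[w wk ->] i ki; rewrite scalerA comm_T_prodX //; try lia.
by rewrite -scalerA wk.
Qed.

Lemma Lk_cst k c v : Lk k v -> Lk k (cst c *: v : V).
Proof. by case=> w _ <-; exists (cst c *: w) => //; rewrite !scalerA cstC. Qed.

Lemma Lk_T k i v : (k <= n)%N -> (0 < i < k)%N -> Lk k v -> Lk k (T i *: v : V).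
Proof.
move=> k_n ik /LkP[w wk ->]; apply/LkP; exists (T i *: w).
  by move=> j kj; rewrite scalerA dT_comm; [rewrite -scalerA wk //| | |]; lia.
by rewrite !scalerA comm_T_prodX //; lia.
Qed.

Lemma Lk_Y k i v : (k <= n)%N -> (0 < i <= k)%N -> Lk k v -> Lk k (Y i *: v : V).
Proof.
move=> k_n ik /LkP[w wk ->]; have [U YU UT] := Y_prodX t q0 ik k_n.
apply/LkP; exists (U *: w); last by rewrite !scalerA YU.
by move=> j kj; rewrite scalerA UT // -scalerA wk.
Qed.

Lemma Lk_dp k v : (k < n)%N -> Lk k v -> Lk k.+1 (act_dp q t n k *: v : V).
Proof.
(* The witness comes from q^k S_1 ... S_k X_1 ... X_k = X_2 ... X_(k+1) T_1 ... T_k. *)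
move=> k_n /LkP[w wk ->]; apply/LkP; exists (\prod_(1 <= i < k.+1) T i *: w).
  move=> j kj; rewrite scalerA.
  have C : GRing.comm (T j) (\prod_(1 <= i < k.+1) T i).
    by apply: commr_prod_nat => i ik; apply: dT_comm; lia.
  by rewrite C -scalerA wk //; lia.
rewrite !scalerA; congr (_ *: _); rewrite act_dpE // -!mulrA prodS_prodX //.
rewrite cstCA cstMM mulfV ?expf_neq0 // rmorph1 mul1r mulrA; congr (_ * _).
by rewrite [RHS]big_nat_recl.
Qed.

Lemma dTSS i x : (0 < i)%N -> (i.+1 < n)%N ->
  T i * (S i.+1 * (S i * x)) = S i.+1 * (S i * (T i.+1 * x)).
Proof.
move=> i0 i_n; rewrite -[RHS](@dTVK _ _ _ _ q0 i) ?dSSS //; last by lia.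
by rewrite dSVK.
Qed.

(** D_k adds T_k to the elements fixing v. For i > k, apply induction to S_k v. For i = k, expand
    D_k v = (v + q S_k v) + q^2 D_(k+2) S_(k+1) S_k v: the bracket is symmetric, and T_k crosses the
    last term to reach v as T_(k+1). *)
Lemma dD_inv k v : (0 < k <= n)%N -> inv k v -> inv k.-1 (dD q t n k *: v).
Proof.
have [m] := ubnP (n - k); elim: m k v => // m IH k v km k_n vk i ki.
have [?|nkn] := eqVneq k n; first by lia.
have Sv : inv k.+1 (S k *: v).
  by move=> j kj; rewrite scalerA -dST; [rewrite -scalerA vk //| | |]; lia.
rewrite dD_rec //; last by lia.
rewrite scalerDl scale1r -!scalerA; have [?|nik] := eqVneq i k; last first.
  rewrite scalerDr vk; last by lia.
  by rewrite [T i *: (cst q *: _)]scalerA cstC -scalerA IH //; lia.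
subst i.
have symm x : T k *: (x + cst q *: (S k *: x)) = x + cst q *: (S k *: x) :> V.
  rewrite scalerDr [T k *: (cst q *: _)]scalerA cstC -scalerA [T k *: (S k *: _)]scalerA.
  rewrite dTK //; last by lia.
  rewrite scale1r [cst q *: (S k *: _)]scalerA dTinvE // scalerDl rmorphB rmorph1.
  by rewrite scalerBl scale1r [RHS]addrCA [x + _]addrC subrK.
have [k1n|nk1] := eqVneq k.+1 n; first by rewrite k1n dD_n scale1r symm.
rewrite dD_rec //; last by lia.
rewrite [(1 + _) *: _]scalerDl scale1r [cst q *: (_ + _)]scalerDr addrA scalerDr symm.
congr (_ + _).
have E : T k *: (dD q t n k.+2 *: (S k.+1 *: (S k *: v))) =
    dD q t n k.+2 *: (S k.+1 *: (S k *: v)).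
  have C : GRing.comm (T k) (dD q t n k.+2).
    by apply: dD_comm => // [|j kj]; [lia | apply: dT_comm; lia].
  rewrite scalerA C -scalerA; congr (_ *: _); rewrite !scalerA -mulrA.
  have := @dTSS k 1; rewrite !mulr1 => ->; try lia.
  by rewrite -!scalerA (vk k.+1) //; lia.
have Tc x : T k *: (cst q *: x) = cst q *: (T k *: x) :> V by rewrite !scalerA cstC.
by rewrite -!scalerA !Tc E.
Qed.

Lemma Lk_dm k v : (0 < k <= n)%N -> Lk k v -> Lk k.-1 (act_dm q t n k *: v : V).
Proof.
move=> k_n /LkP[w wk ->]; apply/LkP.
(* D_k commutes with X_1 ... X_(k-1) but not past X_k, so X_k stays with w, where it preserves
   invariance under the T_i with i > k. *)
exists (cst (q - 1) *: (dD q t n k *: (X k *: w))).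
  move=> i ki; rewrite scalerA cstC -scalerA dD_inv // => j kj.
  by rewrite scalerA dTX_comm; [rewrite -scalerA wk //| | | |]; lia.
rewrite !scalerA; congr (_ *: _); rewrite act_dmE.
have -> : XX k = XX k.-1 * X k by rewrite big_nat_recr /= ?prednK //; lia.
rewrite -!mulrA cstCA; congr (_ * _); rewrite !mulrA; congr (_ * _).
apply/esym/dD_comm => // [|i ki]; first by lia.
by apply/esym; apply: comm_T_prodX; lia.
Qed.
End Module.
End Symmetrizer.

(** * The action of B_{q,t} *)

Section BAction.
Variables (K : fieldType) (q t : K) (n : nat).
Local Notation D := (Dplus q t n).
Local Notation T := (dT q t n).
Local Notation Y := (dY q t n).
Local Notation cst := (dcst q t n).
Local Notation S := (dS q t n).
Local Notation act_dp := (act_dp q t n).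
Local Notation act_dm := (act_dm q t n).
Variable V : lmodType D.
Local Notation W := {ffun 'I_n.+1 -> V}.

Definition bcoef (g : bgen) : D :=
  match g with
  | Be _ => 1
  | BT _ i => T i
  | Bz _ i => cst (q * t)^-1 * Y i
  | Bdp k => act_dp k
  | Bdm k => act_dm k
  end.

Definition bpath (k l : nat) (a : D) (x : W) : W := Lsingle l (a *: x (inord k)).

(** The generators act on all families of n + 1 vectors, which lets [beval] recurse on raw
    expressions; the relations are proved for families in L_bullet. *)
Definition bact (g : bgen) (x : W) : W :=
  if bgen_ok g && bgen_upto n g then bpath (bsrc g) (btgt g) (bcoef g) x else 0.

Definition cact (c : K) (x : W) : W := [ffun k => cst c *: x k].

Fixpoint beval (e : nexpr K bgen) (x : W) : W :=
  match e with
  | Gen g => bact g x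
  | Cst c => cact c x
  | Add a b => beval a x + beval b x
  | Mul a b => beval a (beval b x)
  end.

Lemma bpathM k l m a b x : (l <= n)%N ->
  bpath l m b (bpath k l a x) = bpath k m (b * a) x.
Proof. by move=> ln; rewrite /bpath /Lsingle !ffunE inordK ?eqxx ?scalerA. Qed.

Lemma bpath_neq k l l' m a b x : (l' <= n)%N -> l != l' ->
  bpath l' m b (bpath k l a x) = 0.
Proof.
move=> ln ll; rewrite /bpath /Lsingle !ffunE inordK // eq_sym (negbTE ll) scaler0.
by apply/ffunP => j; rewrite !ffunE if_same.
Qed.

Lemma bpathD k l a b x : bpath k l a x + bpath k l b x = bpath k l (a + b) x.
Proof.
by apply/ffunP => j; rewrite !ffunE; case: ifP => _; rewrite ?addr0 ?scalerDl.
Qed.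

Lemma bpathZ k l c a x : cact c (bpath k l a x) = bpath k l (cst c * a) x.
Proof.
by apply/ffunP => j; rewrite !ffunE; case: ifP => _; rewrite ?scaler0 ?scalerA.
Qed.

Lemma bpath0 k l a : bpath k l a 0 = 0.
Proof. by apply/ffunP => j; rewrite !ffunE scaler0 if_same. Qed.

Lemma bpath_eq k l a b (x : W) : a *: x (inord k) = b *: x (inord k) ->
  bpath k l a x = bpath k l b x.
Proof. by rewrite /bpath => ->. Qed.

Lemma bpath_add k l a x y : bpath k l a (x + y) = bpath k l a x + bpath k l a y.
Proof.
by apply/ffunP => j; rewrite !ffunE; case: ifP => _; rewrite ?addr0 ?scalerDr.
Qed.

Lemma bactE g x : bgen_ok g -> bgen_upto n g ->
  bact g x = bpath (bsrc g) (btgt g) (bcoef g) x.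
Proof. by rewrite /bact => -> ->. Qed.

Lemma bact_T k i x : (k <= n)%N -> (0 < i < k)%N -> bact (BT k i) x = bpath k k (T i) x.
Proof. by move=> kn ik; rewrite bactE // /bgen_upto /= kn. Qed.

Lemma bact_z k i x : (k <= n)%N -> (0 < i <= k)%N ->
  bact (Bz k i) x = bpath k k (cst (q * t)^-1 * Y i) x.
Proof. by move=> kn ik; rewrite bactE // /bgen_upto /= kn. Qed.

Lemma bact_e k x : (k <= n)%N -> bact (Be k) x = bpath k k 1 x.
Proof. by move=> kn; rewrite bactE // /bgen_upto /= kn. Qed.

Lemma bact_dp k x : (k < n)%N -> bact (Bdp k) x = bpath k k.+1 (act_dp k) x.
Proof. by move=> kn; rewrite bactE // /bgen_upto /= kn ltnW. Qed.

Lemma bact_dm k x : (0 < k <= n)%N -> bact (Bdm k) x = bpath k k.-1 (act_dm k) x.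
Proof.
move=> /andP[k0 kn]; rewrite bactE // /bgen_upto /= kn /=.
by apply: leq_trans kn; apply: leq_pred.
Qed.

Lemma bact_bad g x : ~~ bgen_ok g -> bact g x = 0.
Proof. by rewrite /bact => /negbTE ->. Qed.

Lemma bact_src g x : (n < bsrc g)%N -> bact g x = 0.
Proof. by rewrite /bact /bgen_upto [(bsrc g <= n)%N]leqNgt => ->; rewrite andbF. Qed.

Lemma bact_tgt g x : (n < btgt g)%N -> bact g x = 0.
Proof. by rewrite /bact /bgen_upto [(btgt g <= n)%N]leqNgt => ->; rewrite !andbF. Qed.

Lemma bact0 g : bact g 0 = 0.
Proof. by rewrite /bact; case: ifP => // _; rewrite bpath0. Qed.

Lemma cact0 c : cact c 0 = 0.
Proof. by apply/ffunP => j; rewrite !ffunE scaler0. Qed.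

Lemma cact_0l x : cact 0 x = 0.
Proof. by apply/ffunP => j; rewrite !ffunE rmorph0 scale0r. Qed.

Lemma cact_1l x : cact 1 x = x.
Proof. by apply/ffunP => j; rewrite !ffunE rmorph1 scale1r. Qed.

Lemma beval_add e x y : beval e (x + y) = beval e x + beval e y.
Proof.
elim: e x y => [g|c|a IHa b IHb|a IHa b IHb] x y /=.
- by rewrite /bact; case: ifP => _; rewrite ?addr0 ?bpath_add.
- by apply/ffunP => j; rewrite !ffunE scalerDr.
- by rewrite IHa IHb addrACA.
- by rewrite IHb IHa.
Qed.

Lemma beval_cact e c x : beval e (cact c x) = cact c (beval e x).
Proof.
elim: e x => [g|c'|a IHa b IHb|a IHa b IHb] x /=.
- rewrite /bact; case: ifP => _; last by rewrite cact0.
  apply/ffunP => j; rewrite !ffunE; case: ifP => _; last by rewrite scaler0.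
  by rewrite !scalerA cstC.
- by apply/ffunP => j; rewrite !ffunE !scalerA cstC.
- by rewrite IHa IHb; apply/ffunP => j; rewrite !ffunE scalerDr.
- by rewrite IHb IHa.
Qed.

Hypothesis qtr : transcendental q.
Let q0 := transcendental_neq0 qtr.
Let q1 := transcendental_neq1 qtr.

Local Notation LV := (@Lpred K q t n V).

Lemma LpredP (x : W) : reflect (forall k, (k <= n)%N -> Lk k (x (inord k))) (x \in LV).
Proof.
apply: (iffP (asboolP _)) => xL k; first by move=> kn; have := xL (inord k); rewrite inordK.
by have := xL k; rewrite inord_val; apply; rewrite -ltnS.
Qed.

Lemma Lsingle_Lpred l (v : V) : Lk l v -> Lsingle l v \in LV.
Proof.
move=> vl; apply/asboolP => k; rewrite ffunE; case: eqP => [->|_] //.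
by case: (Lk_zmod V k).
Qed.

Lemma bact_Lpred g x : x \in LV -> bact g x \in LV.
Proof.
move=> /LpredP xL; rewrite /bact; case: ifP => [/andP[gok /andP[gs gt]]|_]; last exact: rpred0.
apply: Lsingle_Lpred; move/(_ _ gs): xL.
case: g gok gs gt => [k|k i|k i|k|k] /= gok gs gt vL; rewrite ?scale1r //.
- exact: Lk_T.
- by rewrite -scalerA; apply/Lk_cst/Lk_Y.
- exact: Lk_dp.
- by apply: Lk_dm; rewrite ?gok.
Qed.

Lemma beval_Lpred e x : x \in LV -> beval e x \in LV.
Proof.
elim: e x => [g|c|a IHa b IHb|a IHa b IHb] x xL /=; first exact: bact_Lpred.
- by apply/LpredP => k kn; rewrite ffunE; apply: Lk_cst; move/LpredP: xL; apply.
- by rewrite rpredD ?IHa ?IHb.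
- by apply/IHa/IHb.
Qed.

Lemma beval_dd k x : (0 < k)%N -> (k < n)%N ->
  bact (Bdp k.-1) (bact (Bdm k) x) = bpath k k (act_dp k.-1 * act_dm k) x /\
  bact (Bdm k.+1) (bact (Bdp k) x) = bpath k k (act_dm k.+1 * act_dp k) x.
Proof.
move=> k0 kn; rewrite !bact_dm ?bact_dp ?k0 //; try lia.
by rewrite !bpathM ?(prednK k0) //; lia.
Qed.

Lemma beval_dd_n x : (0 < n)%N ->
  bact (Bdp n.-1) (bact (Bdm n) x) = bpath n n (act_dp n.-1 * act_dm n) x /\
  bact (Bdm n.+1) (bact (Bdp n) x) = 0.
Proof.
move=> n0; rewrite [bact (Bdm n.+1) _]bact_src // bact_dm ?n0 ?leqnn // bact_dp; last by lia.
by rewrite bpathM ?(prednK n0) //; lia.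
Qed.

Lemma beval_bphi k x : (0 < k <= n)%N ->
  beval (bphi q k) x = bpath k k (dphi q t n k) x.
Proof.
move=> /andP[k0 kn] /=; have [{}kn|nk] := ltnP k n.
  have [-> ->] := beval_dd x k0 kn.
  rewrite !bpathZ bpathD bpathZ rmorphN rmorph1 mulN1r dphiE //; lia.
have {kn nk} kE : k = n by lia.
subst k; have [-> ->] := beval_dd_n x k0.
by rewrite cact0 addr0 bpathZ dphi_n.
Qed.

Lemma dSYS i : (0 < i < n)%N -> S i * (Y i.+1 * S i) = cst q^-1 * Y i.
Proof.
move=> h; apply: (cst_inj q0); rewrite cstMM mulfV // rmorph1 mul1r.
by rewrite -cstCA [cst q * _]mulrA -dTYT // -!mulrA dTK // mulr1 dSVK.
Qed.

Lemma beval_Ti k i x : (k <= n)%N -> (0 < i < k)%N ->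
  beval (q^-1%R *: (Gen (BT k i) + (q - 1)%R *: Gen (Be k)))%nx x = bpath k k (S i) x.
Proof.
move=> kn ik; rewrite -dTinv_dS /= bact_T // bact_e // bpathZ mulr1 bpathD bpathZ.
by [].
Qed.

(** The cases follow the order of the defining relations. When a path leaves the vertices 0, ..., n,
    both sides vanish, except for the terms [d_+, d_-] at k = n, where d_+ d_- survives. *)
Lemma beval_rel a b x : B_rel q t a b -> x \in LV -> beval a x = beval b x.
Proof.
move=> ab xL; have xk := LpredP _ xL.
have z g : (n < bsrc g)%N -> bact g x = 0 by apply: bact_src.
have zero := (bact0, cact0, addr0).
case: ab => {a b}.
- by move=> g gok; rewrite /= bact_bad // cact_0l.
- move=> k l kl /=; rewrite cact_0l.
  have [ln|ln] := leqP l n; last by rewrite z // bact0.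
  have [kn|kn] := leqP k n; last by rewrite bact_src.
  by rewrite !bact_e // bpath_neq 1?eq_sym.
- move=> k /=; have [kn|kn] := leqP k n; last by rewrite !z ?bact0.
  by rewrite !bact_e // bpathM // mulr1.
- move=> g /=; have [gn|gn] := leqP (bsrc g) n; last by rewrite !z ?bact0.
  rewrite bact_e // /bact; case: ifP => // _.
  by rewrite bpathM // mulr1.
- move=> g /=; have [gn|gn] := leqP (btgt g) n; last by rewrite !bact_tgt.
  rewrite bact_e // /bact; case: ifP => // _; last by rewrite bpath0.
  by rewrite bpathM // mul1r.
- move=> k i ik /=; have [kn|kn] := leqP k n; last by rewrite !z // !zero cact_0l.
  rewrite cact_0l !bact_T // !bact_e // !bpathZ !bpathD !bpathM //.
  rewrite !rmorphN rmorph1 !mulr1 dT_quad; last by lia.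
  by apply/ffunP => j; rewrite !ffunE scale0r if_same.
- move=> k i i0 ik /=; have [kn|kn] := leqP k n; last by rewrite !z // !zero.
  by rewrite !bact_T ?bpathM -?mulrA ?dT_braid //; lia.
- move=> k i j ik jk ij /=; have [kn|kn] := leqP k n; last by rewrite !z // !zero.
  by rewrite !bact_T ?bpathM 1?dT_comm //; lia.
- move=> k i ik; have [kn|kn] := leqP k n; last by rewrite /= !z // !zero.
  transitivity (bpath k k (S i) (bact (Bz k i.+1) (bpath k k (S i) x))).
    by rewrite -!beval_Ti.
  rewrite /= !bact_z ?bpathM ?bpathZ; try lia.
  by rewrite [S i * _]cstCA -!mulrA dSYS ?[cst q^-1 * (cst _ * _)]cstCA //; lia.
- move=> k i j ik jk ij ij' /=; have [kn|kn] := leqP k n; last by rewrite !z // !zero.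
  rewrite !bact_T ?bact_z ?bpathM; try lia.
  by rewrite -mulrA -[Y i * _]dTY_comm ?cstCA //; lia.
- move=> k i j ik jk /=; have [kn|kn] := leqP k n; last by rewrite !z // !zero.
  rewrite !bact_z ?bpathM; try lia.
  by rewrite !cstCA -!mulrA dY_comm //; lia.
- move=> k k2 /=; have [kn|kn] := leqP k n; last by rewrite !z // !zero.
  by rewrite !bact_dm ?bact_T ?bpathM ?act_dm2_T //; lia.
- move=> k i ik /=; have [kn|kn] := leqP k n; last by rewrite !z // !zero.
  rewrite !bact_dm ?bact_T ?bpathM; try lia.
  by rewrite -act_dm_comm // => [|j kj]; [lia | apply: dT_comm; lia].
- move=> k /=; have [kn|kn] := ltnP k.+1 n; last first.
    by rewrite ![bact (Bdp k.+1) _]bact_tgt ?bact0.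
  rewrite !bact_dp ?bact_T ?bpathM; try lia.
  by apply: bpath_eq; apply: T_act_dp2 => //; apply/Lk_inv/xk => //; lia.
- move=> k i ik /=; have [kn|kn] := ltnP k n; last first.
    by rewrite ![bact (Bdp k) _]bact_tgt ?bact0.
  by rewrite !bact_dp ?bact_T ?bpathM ?act_dpT //; lia.
- move=> k k2; have [kn|kn] := leqP k n; last by rewrite /= !z // !zero.
  (* These equations evaluate the outer operations while keeping varphi folded, so that [beval_bphi]
     can replace it as a whole. *)
  have E y : beval (q *: (bphi q k.-1 * Gen (Bdm k)))%nx y =
    cact q (beval (bphi q k.-1) (bact (Bdm k) y)) by [].
  have E' y : beval (Gen (Bdm k) * bphi q k * Gen (BT k k.-1))%nx y =
    bact (Bdm k) (beval (bphi q k) (bact (BT k k.-1) y)) by [].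
  rewrite {}E {}E' !beval_bphi; try lia.
  by rewrite !bact_dm ?bact_T ?bpathM ?bpathZ ?dphi_dm ?mulrA //; lia.
- move=> k k0; have [kn|kn] := ltnP k n; last first.
    have [{}kn|nk] := ltnP n k; first by rewrite /= !z // !zero.
    by rewrite /= [bact (Bdp k) x]bact_tgt // ![bact (Bdp k) _]bact_tgt // !zero.
  have E y : beval (Gen (BT k.+1 1) * bphi q k.+1 * Gen (Bdp k))%nx y =
    bact (BT k.+1 1) (beval (bphi q k.+1) (bact (Bdp k) y)) by [].
  have E' y : beval (q *: (Gen (Bdp k) * bphi q k))%nx y =
    cact q (bact (Bdp k) (beval (bphi q k) y)) by [].
  rewrite {}E {}E' !beval_bphi; try lia.
  by rewrite !bact_dp ?bact_T ?bpathM ?bpathZ -?dphi_dp ?mulrA //; lia.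
- move=> k i ik /=; have [kn|kn] := leqP k n; last by rewrite !z // !zero.
  rewrite !bact_dm ?bact_z ?bpathM; try lia.
  rewrite -act_dm_comm //; first by lia.
  move=> j kj; apply/esym/commrM; first exact: cstC.
  by apply: dTY_comm; lia.
- move=> k i ik /=; have [kn|kn] := ltnP k n; last first.
    by rewrite ![bact (Bdp k) _]bact_tgt ?bact0.
  rewrite !bact_dp ?bact_z ?bpathM; try lia.
  by rewrite cstCA -mulrA act_dpY //; lia.
move=> k k0; have [{}kn|nk] := ltnP k n; last first.
  have [{}kn|kn] := ltnP n k; first by rewrite /= !z // !zero.
  have {kn nk} kE : k = n by lia.
  subst k; rewrite /=.
  have [-> ->] := beval_dd_n x k0; have [-> ->] := beval_dd_n (bact (Bz n n) x) k0.
  rewrite !cact0 !addr0 !bact_z ?k0 ?leqnn // !(bpathM, bpathZ) //.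
  rewrite -[cst (q * t) * _ * _]mulrA.
  apply: bpath_eq; apply: z_act_zdd_n => //.
  by apply: Lk_inv => //; apply: xk.
rewrite /=; have [-> ->] := beval_dd x k0 kn.
have [-> ->] := beval_dd (bact (Bz k k) x) k0 kn.
rewrite !bact_z ?k0 ?leqnn ?(ltnW kn) // !(bpathM, bpathZ, bpathD) ?(ltnW kn) //.
rewrite !rmorphN !rmorph1 -mulrDl !mulN1r.
apply: bpath_eq; apply: z_act_zdd => //; first by rewrite k0.
by apply: Lk_inv; rewrite ?(ltnW kn) //; apply: xk; apply: ltnW.
Qed.
End BAction.

(** * The module structure on L_bullet *)

Section BModule.
Variables (K : fieldType) (q t : K) (n : nat).
Local Notation D := (Dplus q t n).
Local Notation B := (Bn q t n).
Hypothesis qtr : transcendental q.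

Section Scale.
Variable V : lmodType D.
Local Notation W := {ffun 'I_n.+1 -> V}.
Local Notation LV := (@Lpred K q t n V).
Local Notation beval := (@beval K q t n V).
Local Notation bact := (@bact K q t n V).

(** For products, the left factors are compared at the image of x under the right factor, hence the
    appeal to stability of L_bullet. *)
Lemma beval_pcong a b x : pcong (B_rel q t) a b -> x \in LV -> beval a x = beval b x.
Proof.
move=> ab; elim: ab x => {a b} /=.
- by move=> a b ab x; apply: beval_rel.
- by [].
- by move=> a b _ IH x xL; rewrite IH.
- by move=> a b c _ IH _ IH' x xL; rewrite IH ?IH'.
- by move=> a a' b b' _ IH _ IH' x xL; rewrite IH ?IH'.
- by move=> a a' b b' _ IH _ IH' x xL; rewrite IH' // IH //; apply: beval_Lpred.
- by move=> *; rewrite addrA.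
- by move=> *; rewrite addrC.
- by move=> *; rewrite cact_0l add0r.
- by [].
- by move=> *; rewrite cact_1l.
- by move=> *; rewrite !cact_0l.
- by [].
- by move=> *; rewrite beval_add.
- by move=> a b x _; apply/ffunP => j; rewrite !ffunE rmorphD scalerDl.
- by move=> a b x _; apply/ffunP => j; rewrite !ffunE rmorphM scalerA.
- by move=> *; rewrite beval_cact.
Qed.

(** On L_bullet the choice of representative is immaterial, by [beval_pcong]. *)
Definition aeval (a : palg (B_rel q t)) (x : W) : W := beval (generic_quotient.repr a) x.

Lemma aeval_pcls e x : x \in LV -> aeval (pcls _ e) x = beval e x.
Proof. by apply: beval_pcong; apply: repr_pcls. Qed.

Lemma aeval_Lpred a x : x \in LV -> aeval a x \in LV.
Proof. exact: beval_Lpred. Qed.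

Lemma aevalD a b x : x \in LV -> aeval (a + b) x = aeval a x + aeval b x.
Proof. by move=> xL; rewrite -{1}[a]pcls_repr -{1}[b]pcls_repr -pclsD aeval_pcls. Qed.

Lemma aevalM a b x : x \in LV -> aeval (a * b) x = aeval a (aeval b x).
Proof. by move=> xL; rewrite -{1}[a]pcls_repr -{1}[b]pcls_repr -pclsM aeval_pcls. Qed.

Lemma aeval0 x : x \in LV -> aeval 0 x = 0.
Proof. by move=> xL; rewrite -[0]/(pcls _ _) aeval_pcls //= cact_0l. Qed.

Lemma aeval_gen g x : x \in LV -> aeval (pgen _ g) x = bact g x.
Proof. by move=> xL; rewrite aeval_pcls. Qed.

Lemma aeval_cst c x : x \in LV -> aeval (pcst _ c) x = cact c x.
Proof. by move=> xL; rewrite aeval_pcls. Qed.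

Lemma aeval_Bn_one x : x \in LV -> aeval (Bn_one q t n) x = x.
Proof.
move=> xL; rewrite /Bn_one.
have -> : aeval (\sum_(k < n.+1) pgen (B_rel q t) (Be k)) x = \sum_(k < n.+1) bact (Be k) x.
  elim/big_rec2: _ => [|k y a _ IH]; first by rewrite aeval0.
  by rewrite aevalD // IH aeval_gen.
apply/ffunP => j; rewrite sum_ffunE (bigD1 j) //= big1 ?addr0 => [|k kj].
  by rewrite bact_e ?ffunE ?eqxx ?scale1r ?inord_val // -ltnS.
by rewrite bact_e -1?ltnS // !ffunE val_eqE eq_sym (negbTE kj).
Qed.

Definition Lscale (b : B) (x : Lbullet V) : Lbullet V :=
  LBullet (aeval_Lpred (val b) (L_valP x)).

Lemma LscaleA a b x : Lscale a (Lscale b x) = Lscale (a * b) x.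
Proof. by apply: val_inj; rewrite /= aevalM // L_valP. Qed.

Lemma Lscale1 : left_id 1 Lscale.
Proof. by move=> x; apply: val_inj; rewrite /= aeval_Bn_one // L_valP. Qed.

Lemma LscaleDr : right_distributive Lscale +%R.
Proof. by move=> a x y; apply: val_inj; rewrite /= /aeval beval_add. Qed.

Lemma LscaleDl x : {morph Lscale^~ x : a b / a + b}.
Proof. by move=> a b; apply: val_inj; rewrite /= aevalD // L_valP. Qed.

Definition Lmixin : GRing.Zmodule_isLmodule B (Lbullet V) :=
  GRing.Zmodule_isLmodule.Build B (Lbullet V) LscaleA Lscale1 LscaleDr LscaleDl.
End Scale.

Lemma beval_linear (U V : lmodType D) (f : {linear U -> V}) e (x : {ffun 'I_n.+1 -> U}) :
  beval e [ffun k => f (x k)] = [ffun k => f (beval e x k)].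
Proof.
elim: e x => [g|c|a IHa b IHb|a IHa b IHb] x /=.
- rewrite /bact; case: ifP => _; apply/ffunP => j; rewrite !ffunE ?linear0 //.
  by case: ifP => _; rewrite ?linear0 ?linearZ.
- by apply/ffunP => j; rewrite !ffunE linearZ.
- by rewrite IHa IHb; apply/ffunP => j; rewrite !ffunE linearD.
- rewrite IHb IHa //.
Qed.

End BModule.

(** * Gradings and functoriality *)

Section Degrees.
Variables (K : fieldType) (q t : K) (n : nat).
Local Notation D := (Dplus q t n).
Local Notation B := (Bn q t n).
Local Notation cst := (dcst q t n).
Local Notation deg := (@Dplus_deg K q t n).

Lemma deg_cst c : deg 0 (cst c).
Proof. exact: sh_cst. Qed.

Lemma deg_one : deg 0 1.
Proof. by rewrite -(rmorph1 (dcst q t n)); apply: deg_cst. Qed.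

Lemma deg_mul d e (x y : D) : deg d x -> deg e y -> deg (d + e) (x * y).
Proof. exact: sh_mul. Qed.

Lemma deg_T i : deg 0 (dT q t n i).
Proof. exact: (@sh_gen _ _ _ _ (dpos_family q t n) dgen_deg (DT i)). Qed.

Lemma deg_X i : deg 1 (dX q t n i).
Proof. exact: (@sh_gen _ _ _ _ (dpos_family q t n) dgen_deg (DX i)). Qed.

Lemma deg_Y i : deg 0 (dY q t n i).
Proof. exact: (@sh_gen _ _ _ _ (dpos_family q t n) dgen_deg (DY i)). Qed.

Lemma deg_prod0 (I : Type) (r : seq I) (F : I -> D) :
  (forall i, deg 0 (F i)) -> deg 0 (\prod_(i <- r) F i).
Proof.
move=> F0; elim/big_rec: _ => [|i x _]; first exact: deg_one.
exact: (@deg_mul 0 0).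
Qed.

Lemma deg_sum d (I : Type) (r : seq I) (P : pred I) (F : I -> D) :
  (forall i, deg d (F i)) -> deg d (\sum_(i <- r | P i) F i).
Proof.
move=> Fd; elim/big_rec: _ => [|i x _ xd]; first exact: sh_0.
by apply: sh_add xd; apply: Fd.
Qed.

Lemma deg_Tinv i : deg 0 (dTinv q t n i).
Proof.
by apply: (@deg_mul 0 0); [apply: deg_cst | apply: sh_add; [apply: deg_T | apply: deg_cst]].
Qed.

Lemma deg_deps k : deg 0 (deps q t n k).
Proof.
apply: (@deg_mul 0 0); first exact: deg_cst.
apply: deg_sum => s; apply: (@deg_mul 0 0); first exact: deg_cst.
by apply: deg_prod0 => i; apply: deg_T.
Qed.

Lemma deg_Lproj k : deg k (Lproj q t n k).
Proof.
rewrite /Lproj -[k in deg k]addn0; apply: deg_mul; last exact: deg_deps.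
elim: k => [|k IH]; first by rewrite big_nil; apply: deg_one.
by rewrite big_nat_recr //=; have := deg_mul IH (deg_X k.+1); rewrite addn1.
Qed.

Lemma deg_bcoef g : deg (bgen_deg g) (bcoef q t n g).
Proof.
case: g => [k|k i|k i|k|k] /=.
- exact: deg_one.
- exact: deg_T.
- by apply: (@deg_mul 0 0); [apply: deg_cst | apply: deg_Y].
- apply: (@deg_mul 1 0); first by apply: (@deg_mul 0 1); [apply: deg_cst | apply: deg_X].
  by apply: deg_prod0 => i; apply: deg_Tinv.
- apply: (@deg_mul 0 0); first exact: deg_cst.
  apply: deg_sum => j; apply: (@deg_mul 0 0); first exact: deg_cst.
  by apply: deg_prod0 => i; apply: deg_Tinv.
Qed.

Hypothesis qtr : transcendental q.

(** * The grading of L_bullet *)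

Section Graded.
Variable V : gmod (@Dplus_deg K q t n).
Let gV := gm_grading V.

Lemma gm_deg_add d (v w : V) : gm_deg d v -> gm_deg d w -> gm_deg d (v + w).
Proof.
move=> vd wd; rewrite -[w]opprK; apply: (gradB gV) => //.
by rewrite -sub0r; apply: (gradB gV) => //; apply: (grad0 gV).
Qed.

Lemma bact_deg d g (x : {ffun 'I_n.+1 -> V}) : (forall k, gm_deg d (x k)) ->
  forall k, gm_deg (bgen_deg g + d) (bact g x k).
Proof.
move=> xd k; rewrite /bact; case: ifP => _; rewrite !ffunE; last exact: (grad0 gV).
case: ifP => _; last exact: (grad0 gV).
by apply: (grad_act gV) => //; apply: deg_bcoef.
Qed.

Local Notation scale := (@Lscale K q t n qtr V).

Lemma Lscale_deg d e (b : B) (x : Lbullet V) :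
  Bn_deg d b -> Lbullet_deg e x -> Lbullet_deg (d + e) (scale b x).
Proof.
move=> bd; elim: bd e x => {d b} [g|c|d|d a b _ IHa _ IHb|d d' a b _ IHa _ IHb] e x xe k /=.
- rewrite /= /Bn_fam; case: ifP => _.
    by rewrite aeval_gen ?L_valP //; exact: (@bact_deg e g (L_val x) xe k).
  by rewrite aeval0 ?L_valP // ffunE; apply: (grad0 gV).
- rewrite aevalM ?L_valP // aeval_Bn_one ?L_valP // aeval_cst ?L_valP // ffunE.
  by apply: (grad_act gV) => //; apply: deg_cst.
- by rewrite aeval0 ?L_valP // ffunE; apply: (grad0 gV).
- rewrite aevalD ?L_valP // ffunE; apply: gm_deg_add; [exact: IHa | exact: IHb].
- rewrite aevalM ?L_valP // -addnA.
  exact: (IHa _ (scale b x) (IHb _ _ xe)).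
Qed.

(** In the k-th summand, the component of degree d of X_1 ... X_k eps_k w, where
    [w k e] is the component of degree e of w; note that X_1 ... X_k has degree k. *)
Definition Lpart (w : 'I_n.+1 -> nat -> V) (d : nat) : {ffun 'I_n.+1 -> V} :=
  [ffun k : 'I_n.+1 => if (k <= d)%N then Lproj q t n k *: w k (d - k)%N else 0].

Lemma Lpart_Lpred w d : Lpart w d \in @Lpred K q t n V.
Proof.
apply/asboolP => k; rewrite ffunE; case: ifP => _; first by exists (w k (d - k)%N).
by case: (Lk_zmod V k).
Qed.

Lemma Lpart_deg w d k : (forall k d, gm_deg d (w k d)) -> gm_deg d (Lpart w d k).
Proof.
move=> wd; rewrite ffunE; case: ifP => kd; last exact: (grad0 gV).
by rewrite -[d in gm_deg d](subnKC kd); apply: (grad_act gV) => //; apply: deg_Lproj.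
Qed.

Lemma Lgrading :
  is_grading (@Bn_deg K q t n) (V := Llmod (Lmixin qtr V)) (@Lbullet_deg K q t n V).
Proof.
split.
- by move=> d k; rewrite ffunE; apply: (grad0 gV).
- by move=> d x y xd yd k; rewrite !ffunE; apply: (gradB gV).
- move=> x.
  (* Homogeneous components are taken of a preimage under X_1 ... X_k eps_k, because those of L_k
     must themselves lie in L_k. *)
  have /boolp.choice[f fP] : forall k, exists f : nat * (nat -> V),
      (forall d, gm_deg d (f.2 d)) /\
      L_val x k = Lproj q t n k *: \sum_(d < f.1) f.2 d.
    move=> k; have /asboolP/(_ k)[v _ <-] := L_valP x.
    by have [N [w [wd ->]]] := grad_span gV v; exists (N, w).
  pose w k d := if (d < (f k).1)%N then (f k).2 d else 0.
  have wd k d : gm_deg d (w k d).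
    by rewrite /w; case: ifP => _; [apply: (fP k).1 | apply: (grad0 gV)].
  (* X_1 ... X_k raises degrees by k <= n, so M bounds the degrees in every summand. *)
  pose M := (\max_k (f k).1 + n)%N.
  exists M, (fun d => LBullet (Lpart_Lpred w d)); split; first by move=> d k; apply: Lpart_deg.
  apply: val_inj; apply/ffunP => k; rewrite [LHS](fP k).2.
  have -> : val (\sum_(d < M) LBullet (Lpart_Lpred w d)) = \sum_(d < M) Lpart w d.
    exact: (big_morph val (fun=> fun=> erefl) erefl).
  rewrite sum_ffunE.
  have kM : (k + (f k).1 <= M)%N.
    rewrite addnC; apply: leq_add; last by rewrite -ltnS.
    exact: (leq_bigmax_cond (F := fun k => (f k).1)).
  rewrite -(big_mkord xpredT (fun d => Lpart w d k)) (big_cat_nat _ (n := k)) //=; last by lia.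
  rewrite [X in _ = X + _]big_nat [X in _ = X + _]big1 => [|d /andP[_ kd]]; last first.
    by rewrite ffunE leqNgt kd.
  have -> : \sum_(k <= d < M) Lpart w d k = \sum_(0 <= d < M - k) Lpart w (d + k) k.
    by rewrite -[in index_iota k M](add0n k) big_addn.
  rewrite add0r.
  rewrite (big_cat_nat _ (n := (f k).1)) //=; last by lia.
  rewrite [X in _ = _ + X]big_nat [X in _ = _ + X]big1 => [|d /andP[fd _]]; last first.
    by rewrite ffunE leq_addl addnK /w ltnNge fd scaler0.
  rewrite addr0 scaler_sumr -[LHS](big_mkord xpredT (fun d => Lproj q t n k *: (f k).2 d)).
  rewrite big_nat [RHS]big_nat; apply: eq_bigr => d /andP[_ dN].
  by rewrite ffunE leq_addl addnK /w dN.
- move=> N w wd w0 d dN; apply: val_inj; apply/ffunP => k; rewrite ffunE.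
  (* Independence is inherited from V in each summand separately. *)
  apply: (grad_free gV (w := fun d => L_val (w d) k) (N := N)) => // [e|].
    exact: wd.
  have : val (\sum_(d < N) w d) = \sum_(d < N) val (w d).
    exact: (big_morph val (fun=> fun=> erefl) erefl).
  rewrite w0 => /ffunP/(_ k); rewrite sum_ffunE ffunE => E.
  by rewrite -E.
- by move=> d e b x; apply: Lscale_deg.
Qed.

Lemma Lscale_gen g (x : Lbullet V) : bgen_upto n g ->
  L_val (scale (sa_gen (Bn_family q t n) g) x) = bact g (L_val x).
Proof. by move=> gn; rewrite /= /Bn_fam gn aeval_gen ?L_valP. Qed.

Lemma Lscale_cst c (x : Lbullet V) k :
  L_val (scale (bcst q t n c) x) k = cst c *: L_val x k.
Proof.
by rewrite /= aevalM ?L_valP // aeval_Bn_one ?L_valP // aeval_cst ?L_valP // ffunE.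
Qed.

Lemma Lscale_e k (x : Lbullet V) : (k <= n)%N ->
  L_val (scale (be q t n k) x) = Lsingle k (Lcoord x k).
Proof.
by move=> kn; rewrite Lscale_gen ?bact_e /bgen_upto /bpath ?scale1r //= kn.
Qed.

Lemma Lscale_T k i (x : Lbullet V) : (k <= n)%N -> (0 < i < k)%N ->
  L_val (scale (bT q t n k i) x) = Lsingle k (dT q t n i *: Lcoord x k).
Proof. by move=> kn ik; rewrite Lscale_gen ?bact_T // /bgen_upto /= kn. Qed.

Lemma Lscale_z k i (x : Lbullet V) : (k <= n)%N -> (0 < i <= k)%N ->
  L_val (scale (bz q t n k i) x) =
  Lsingle k ((cst (q * t)^-1 * dY q t n i) *: Lcoord x k).
Proof. by move=> kn ik; rewrite Lscale_gen ?bact_z // /bgen_upto /= kn. Qed.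

Lemma Lscale_dp k (x : Lbullet V) : (k < n)%N ->
  L_val (scale (bdp q t n k) x) = Lsingle k.+1 (act_dp q t n k *: Lcoord x k).
Proof. by move=> kn; rewrite Lscale_gen ?bact_dp // /bgen_upto /= kn ltnW. Qed.

Lemma Lscale_dm k (x : Lbullet V) : (0 < k <= n)%N ->
  L_val (scale (bdm q t n k) x) = Lsingle k.-1 (act_dm q t n k *: Lcoord x k).
Proof. by move=> kn; rewrite Lscale_gen ?bact_dm // /bgen_upto /=; lia. Qed.

Definition Lstructure : Lstruct V :=
  LStruct Lgrading Lscale_cst Lscale_e Lscale_T Lscale_z Lscale_dp Lscale_dm.
End Graded.
End Degrees.

(** * Transcendence of q over the rationals *)

Lemma transcendental_morph (K : fieldType) (f : {rmorphism {poly rat} -> K}) :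
  injective f -> transcendental (f 'X).
Proof.
move=> f_inj p p0; pose r : {poly rat} := map_poly intr p.
have -> : map_poly intr p = map_poly f (map_poly polyC r).
  rewrite -!map_poly_comp; apply: eq_map_poly => z /=.
  by rewrite !rmorph_int.
(* The value at f X is the image under f of p(X), that is, of p viewed in Q[X]. *)
rewrite horner_map -[_.['X]]/(r \Po 'X) comp_polyXr -(rmorph0 f) (inj_eq f_inj).
apply: contra_neq p0 => r0; apply: (map_inj_poly (@intr_inj rat)) => //.
by rewrite map_poly0.
Qed.

Lemma qvar_transcendental : transcendental qvar.
Proof.
apply: (@transcendental_morph Qqt (@tofrac {poly {poly rat}} \o polyC)).
by move=> x y /= /eqP; rewrite tofrac_eq => /eqP/polyC_inj.
Qed.

(** * Morphisms and functoriality *)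

Section Functor.
Variables (K : fieldType) (q t : K) (n : nat).
Hypothesis qtr : transcendental q.
Local Notation DMod := (gmodCat (@Dplus_deg K q t n)).
Local Notation BMod := (gmodCat (@Bn_deg K q t n)).

Definition Lobj (W : DMod) : BMod := Lgmod (Lstructure qtr W).

Section Morphism.
Variables (U W : DMod) (phi : mor U W).

(** [Lmap] with its source and target typed as B-modules, so that the linear structure can be
    attached to it. *)
Definition Lfun : gm_sort (Lobj U) -> gm_sort (Lobj W) := Lmap phi.

Lemma Lfun_is_zmod_morphism : zmod_morphism Lfun.
Proof.
by move=> x y; apply: val_inj; apply/ffunP => k; rewrite !ffunE linearB.
Qed.

(** The same representative of b acts on both sides, and linear maps commute with the evaluation of
    any expression. *)
Lemma Lfun_is_scalable : scalable Lfun.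
Proof.
move=> b x; apply: val_inj; apply/esym.
exact: (beval_linear phi (generic_quotient.repr (val b)) (L_val x)).
Qed.

HB.instance Definition _ :=
  GRing.isZmodMorphism.Build (gm_sort (Lobj U)) (gm_sort (Lobj W)) Lfun
    Lfun_is_zmod_morphism.
HB.instance Definition _ :=
  GRing.isScalable.Build (Bn q t n) (gm_sort (Lobj U)) (gm_sort (Lobj W)) _ Lfun
    Lfun_is_scalable.

Lemma Lfun_deg d v : gm_deg (g := Lobj U) d v -> gm_deg (g := Lobj W) d (Lfun v).
Proof. by move=> vd k; rewrite ffunE; apply: gm_funP; apply: vd. Qed.

Definition Lmor : mor (Lobj U) (Lobj W) := GMor (gm_fun := Lfun) Lfun_deg.
End Morphism.

Lemma Lmor_id (U : DMod) : Lmor (Defs.idm U) = Defs.idm (Lobj U).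
Proof. by apply: gmorP => x; apply: val_inj; apply/ffunP => k; rewrite ffunE. Qed.

Lemma Lmor_comp (U V W : DMod) (g : mor V W) (f : mor U V) :
  Lmor (cmp g f) = cmp (Lmor g) (Lmor f).
Proof. by apply: gmorP => x; apply: val_inj; apply/ffunP => k; rewrite !ffunE. Qed.
End Functor.

Theorem corollary3p5 (n : nat) (n_ge1 : (1 <= n)%N) :
  exists (S : forall W : DplusMod n, Lstruct W)
         (F : functor_on (C := DplusMod n) (D := BnMod n) (fun W => Lgmod (S W))),
    forall (U W : DplusMod n) (phi : mor U W) (x : Lbullet U),
      fmor F phi x = Lmap phi x :> Lbullet W.
Proof.
pose qtr := qvar_transcendental.
exists (Lstructure qtr).
(* The formula for the functor on morphisms holds by computation. *)
by exists (FunctorOn (F := Lobj qtr) (Lmor_id qtr (n := n)) (@Lmor_comp _ _ _ _ qtr)).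
Qed.
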